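(* Let $\beta$ be the security parameter, with $n\le\pi(\beta)$ for some fixed but arbitrary polynomial $\pi$. Assume that $T_{\text{Slush}}$ is the number of rounds until Slush reaches (with all but negligible probability with respect to $\beta$) a state where at least $n-O(\sqrt n)$ parties have the same opinion, and that $T_{\text{Slush}}$ is a sufficiently large multiple of $\beta$. Then the Blizzard protocol with threshold $\tau:=2T_{\text{Slush}}$ (and the same parameters $k,\alpha$ as Slush) ensures consensus with all but negligible probability with respect to $\beta$ after at most $7T_{\text{Slush}}$ rounds. This holds even with a $\sqrt n$-bounded adversary.
   Context: All but negligible probability: a function $f(\beta)\ge 0$ is negligible in $\beta$ if for every polynomial $\pi'$ there is $\beta_0\ge 0$ such that $f(\beta)\le 1/\pi'(\beta)$ for all $\beta\ge\beta_0$; an event holds with all but negligible probability if the probability of its complement is negligible. Slush: there are $n$ parties communicating in synchronous rounds, with parameters $k\ge2$ and $\frac k2<\alpha\le k$. Each party holds an opinion in $\{0,1,\bot\}$: a party that proposes a value in $\{0,1\}$ starts with that value as its opinion, and a party that has not proposed starts with $\bot$. In each round every party with opinion in $\{0,1\}$ independently queries $k$ parties drawn uniformly at random with repetition from all $n$ parties, sending its own opinion along with the query. A queried party whose opinion is $\bot$ first adopts the opinion contained in the query (and from then on takes part like the others); every queried party replies with its opinion. If at least $\alpha$ of the $k$ replies equal $b$ (an $\alpha$-majority for $b$), the querying party adopts opinion $b$; otherwise it keeps its opinion. There is no limit on the number of rounds. Blizzard: the same process, where each party additionally keeps counters $cnt[0],cnt[1]$, initially $0$. Whenever its query has an $\alpha$-majority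 for $b$, it adopts $b$ and increases $cnt[b]$ by 1. A party that has not yet decided decides $1$ when $cnt[1]-cnt[0]=\tau$, and decides $0$ when $cnt[0]-cnt[1]=\tau$; a decided party starts no further queries. An $F$-bounded adversary can set the opinion of up to $F$ (undecided) parties at the beginning of each round to one of the opinions $0,1$. Consensus means that the following conditions hold. Termination: every party eventually decides on some opinion. Validity: if all parties propose the same value, then all parties decide on that value. Integrity: no party decides twice. Agreement: no two parties decide differently.
   Formalization: At least one party is assumed to propose, and whenever the adversary may alter some opinion, n must exceed a constant depending on k and the constant in O(√n): for n = 1 a √n-bounded adversary owns the only party and validity fails. Without an adversary every n ≥ 1 is covered. *)

(* Defs.v *)
From mathcomp Require Import all_boot all_order all_algebra.
From mathcomp Require Import reals.

Set Implicit Arguments.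
Unset Strict Implicit.
Unset Printing Implicit Defensive.

Import Order.TTheory GRing.Theory Num.Theory.

Local Open Scope ring_scope.

(* The guard [0 < p.[beta]] skips the arguments at which 1 / p(beta) is not a
   meaningful bound on a nonnegative quantity. *)
Definition negligible (R : realType) (f : nat -> R) : Prop :=
  forall p : {poly R}, exists beta0 : nat, forall beta : nat,
    (beta0 <= beta)%N -> 0 < p.[beta%:R] -> f beta <= 1 / p.[beta%:R].

(* [None] is the opinion "bottom"; [Some false], [Some true] are 0 and 1. *)
Definition opinions (n : nat) := {ffun 'I_n -> option bool}.

(* The random choices of one round: k targets, with repetition, per party.
   The tuples of parties that do not query in the round are ignored. *)
Definition samples (n k : nat) := {ffun 'I_n -> k.-tuple 'I_n}.

(* Probability of an event about N rounds: all samples are independent and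
   uniform, i.e. the sequence of samples is uniform on a finite type. *)
Definition Pr (R : realType) (n k N : nat) (E : pred (N.-tuple (samples n k))) : R :=
  #|E|%:R / #|{: N.-tuple (samples n k)}|%:R.

(* An adaptive adversary with full information: from the samples of the past
   rounds (latest first) it chooses the interventions at the beginning of the
   next round, where [Some b] at i sets the opinion of i to b and [None] leaves
   i alone.  It is not restricted computationally. *)
Definition adversary (n k : nat) :=
  seq (samples n k) -> {ffun 'I_n -> option bool}.

Definition bounded (n k F : nat) (A : adversary n k) : Prop :=
  forall h, (#|[set i | A h i != None]| <= F)%N.

(* If a party with opinion bottom is reached in one synchronous round by
   queries carrying both opinions, the order of arrival matters.  A rule of
   this type returns the opinion carried by the query that arrives first. *)
Definition arrival_rule (k : nat) :=
  forall n : nat, opinions n -> samples n k -> 'I_n -> bool.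

Definition receives (n k : nat) (active : pred 'I_n) (o : opinions n)
    (q : samples n k) (j : 'I_n) (b : bool) : bool :=
  [exists i, [&& active i, o i == Some b & j \in q i]].

(* The opinions with which queries are answered, when the parties in [active]
   query with opinions [o]: bottom is first replaced on receipt of a query. *)
Definition answers (n k : nat) (first : arrival_rule k) (active : pred 'I_n)
    (o : opinions n) (q : samples n k) : opinions n :=
  [ffun j => if o j is Some b then Some b else
     match receives active o q j false, receives active o q j true with
     | true, true => Some (first n o q j)
     | true, false => Some false
     | false, true => Some true
     | false, false => None
     end].

(* At most one value can have an alpha-majority when k < 2 * alpha. *)
Definition alpha_majority (n k alpha : nat) (o : opinions n)
    (t : k.-tuple 'I_n) : option bool :=
  if (alpha <= count (fun j => o j == Some true) t)%N then Some true
  else if (alpha <= count (fun j => o j == Some false) t)%N then Some false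
  else None.

(* State reached after the rounds with samples [h], latest round first. *)
Fixpoint run (n k : nat) (state : Type)
    (step : {ffun 'I_n -> option bool} -> state -> samples n k -> state)
    (A : adversary n k) (s0 : state) (h : seq (samples n k)) : state :=
  if h is q :: h' then step (A h') (run step A s0 h') q else s0.

Definition slush_step (n k alpha : nat) (first : arrival_rule k)
    (c : {ffun 'I_n -> option bool}) (o : opinions n) (q : samples n k) :
    opinions n :=
  let o1 : opinions n := [ffun i => if c i is Some b then Some b else o i] in
  let active : pred 'I_n := fun i => o1 i != None in
  let o2 := answers first active o1 q in
  [ffun i => if active i then
               if alpha_majority alpha o2 (q i) is Some b then Some b else o1 i
             else o2 i].

Definition slush (n k alpha : nat) (first : arrival_rule k)
    (A : adversary n k) (x : opinions n) (h : seq (samples n k)) : opinions n :=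
  run (slush_step alpha first) A x h.

(* [decided] lists all values that the party has decided on so far. *)
Record party := Party {
  opinion : option bool;
  cnt : bool -> nat;
  decided : seq bool
}.

Definition undecided (p : party) : bool := decided p == [::].

Definition decide (tau : nat) (p : party) : party :=
  if ~~ undecided p then p
  else if cnt p true == (cnt p false + tau)%N then
    Party (opinion p) (cnt p) (rcons (decided p) true)
  else if cnt p false == (cnt p true + tau)%N then
    Party (opinion p) (cnt p) (rcons (decided p) false)
  else p.

(* Interventions against decided parties have no effect. *)
Definition blizzard_step (n k alpha tau : nat) (first : arrival_rule k)
    (c : {ffun 'I_n -> option bool}) (s : 'I_n -> party) (q : samples n k) :
    'I_n -> party :=
  let o1 : opinions n :=
    [ffun i => if undecided (s i) then
                 if c i is Some b then Some b else opinion (s i)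
               else opinion (s i)] in
  let active : pred 'I_n := fun i => undecided (s i) && (o1 i != None) in
  let o2 := answers first active o1 q in
  fun i => decide tau
    (if active i then
       if alpha_majority alpha o2 (q i) is Some b then
         Party (Some b) (fun b' => (cnt (s i) b' + (b' == b))%N) (decided (s i))
       else Party (o1 i) (cnt (s i)) (decided (s i))
     else Party (o2 i) (cnt (s i)) (decided (s i))).

Definition blizzard (n k alpha tau : nat) (first : arrival_rule k)
    (A : adversary n k) (x : opinions n) (h : seq (samples n k)) : 'I_n -> party :=
  run (blizzard_step alpha tau first) A
      (fun i => Party (x i) (fun=> 0%N) [::]) h.

Definition someone_proposes (n : nat) (x : opinions n) : bool :=
  [exists i, x i != None].

Definition almost_agree (R : realType) (C : R) (n : nat) (o : opinions n) : bool :=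
  [exists b : bool,
     n%:R - C * Num.sqrt n%:R <= #|[set i | o i == Some b]|%:R :> R].

Definition termination (n : nat) (s : 'I_n -> party) : bool :=
  [forall i, decided (s i) != [::]].

Definition validity (n : nat) (x : opinions n) (s : 'I_n -> party) : bool :=
  [forall b : bool, [forall i, x i == Some b] ==> [forall i, b \in decided (s i)]].

Definition integrity (n : nat) (s : 'I_n -> party) : bool :=
  [forall i, (size (decided (s i)) <= 1)%N].

Definition agreement (n : nat) (s : 'I_n -> party) : bool :=
  [forall i, forall j,
     all (fun b => all (fun b' => b == b') (decided (s j))) (decided (s i))].

(* Once every party has decided no party queries or decides any more, so for a
   state satisfying [termination] these conditions concern the whole run. *)
Definition consensus (n : nat) (x : opinions n) (s : 'I_n -> party) : bool :=
  [&& termination s, validity x s, integrity s & agreement s].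

(* Main.v *)
(* Slush and Blizzard are run on the same samples and against the same adversary.
   No party of Blizzard can decide before round 2T; once every party has an
   opinion, and as long as decisions are made for one value b only, freezing the
   parties that have decided can only help b, so Blizzard stays ahead of Slush
   towards b.  It is therefore enough to bound, in Slush, the margin
   [votes b - votes (~~ b)] of each party from below.

   At any round t >= T Slush almost agrees, since one may restart it at round
   t - T.  Almost agreement cannot jump from b to the other value: resampling the
   parties one by one changes the number of opinions b by steps of at most 1, so a
   jump has at most about 2n times the probability of an intermediate state.  This
   argument is needed because n may be tiny compared with beta, so that there is no
   concentration.  Parties without an opinion disappear between rounds T and 3T/2.
   From then on the margin of each party is a random walk whose exponential moment
   [2 ^ (- margin)] shrinks by a factor 3/5 per round.  If all parties propose b,
   the argument applies from round 0, because an idle adversary can delay the run.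

   For bounded n there is no adversary, and Slush reaches unanimity exponentially
   fast, since from each state some single sample makes progress. *)
Require Import Defs.
From mathcomp Require Import all_boot all_order all_algebra.
From mathcomp Require Import reals boolp.
From mathcomp Require Import zify ring lra.

Set Implicit Arguments.
Unset Strict Implicit.
Unset Printing Implicit Defensive.

Import Order.TTheory GRing.Theory Num.Theory.

Local Open Scope ring_scope.

(** * Averages and expectations *)

Section Average.
Variable R : realFieldType.

Definition avg (I : finType) (f : I -> R) : R := (\sum_i f i) / #|I|%:R.

Lemma le_avg (I : finType) (f g : I -> R) :
  (forall i, f i <= g i) -> avg f <= avg g.
Proof. by move=> fg; rewrite ler_wpM2r ?invr_ge0 ?ler0n// ler_sum. Qed.

Lemma eq_avg (I : finType) (f g : I -> R) : f =1 g -> avg f = avg g.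
Proof. by move=> fg; rewrite /avg (eq_bigr g). Qed.

Lemma avgD (I : finType) (f g : I -> R) :
  avg (fun i => f i + g i) = avg f + avg g.
Proof. by rewrite /avg big_split mulrDl. Qed.

Lemma avg_sum (I J : finType) (f : J -> I -> R) :
  avg (fun i => \sum_j f j i) = \sum_j avg (f j).
Proof. by rewrite /avg exchange_big mulr_suml. Qed.

Lemma avgZ (I : finType) (a : R) (f : I -> R) :
  avg (fun i => a * f i) = a * avg f.
Proof. by rewrite /avg -mulr_sumr mulrA. Qed.

Lemma avg_cst (I : finType) (a : R) : (0 < #|I|)%N -> avg (fun _ : I => a) = a.
Proof.
move=> I0; rewrite /avg sumr_const.
have e : (#|I|%:R : R) != 0 by rewrite pnatr_eq0 -lt0n.
by rewrite -[a *+ _]mulr_natr mulfK.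
Qed.

Lemma avg_nat (I : finType) (P : pred I) :
  avg (fun i => (P i)%:R) = #|P|%:R / #|I|%:R.
Proof.
rewrite /avg -natr_sum -sum1_card [in RHS]big_mkcond.
by congr (_%:R / _); apply: eq_bigr => i _; rewrite -topredE /=; case: (P i).
Qed.

Lemma avg_pair (I J : finType) (f : I -> J -> R) :
  avg (fun p => f p.1 p.2) = avg (fun i => avg (f i)).
Proof.
rewrite /avg -(pair_bigA _ f) /= card_prod natrM invfM mulrA mulrAC.
by rewrite mulr_suml.
Qed.

Lemma avg_bij (I J : finType) (h : I -> J) (f : J -> R) :
  bijective h -> avg (fun i => f (h i)) = avg f.
Proof.
move=> bh; rewrite /avg (bij_eq_card bh); congr (_ / _).
by rewrite (reindex h)//; case: bh => g hg gh; exists g => x _.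
Qed.

(** Independence of the coordinates: a product of sums expands into a sum over all functions. *)
Lemma avg_ffun (I J : finType) (F : J -> I -> R) :
  avg (fun q : {ffun J -> I} => \prod_j F j (q j)) = \prod_j avg (F j).
Proof.
rewrite /avg -bigA_distr_bigA /= big_split /= prodr_const card_ffun natrX.
by rewrite exprVn.
Qed.

Lemma avg_ffun_coord (I J : finType) (i : J) (f : I -> R) : (0 < #|I|)%N ->
  avg (fun q : {ffun J -> I} => f (q i)) = avg f.
Proof.
move=> I0.
(* All factors but one are 1, so that [avg_ffun] yields the marginal. *)
transitivity (avg (fun q : {ffun J -> I} =>
    \prod_j (if j == i then f (q j) else 1))).
  by apply: eq_avg => q; rewrite -big_mkcond big_pred1_eq.
rewrite (avg_ffun (fun j t => if j == i then f t else 1)) (bigD1 i)//= eqxx.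
by rewrite big1 ?mulr1// => j /negPf ->; rewrite avg_cst.
Qed.

Lemma avg_tuple_coord (I : finType) (k : nat) (j : 'I_k) (f : I -> R) :
  (0 < #|I|)%N -> avg (fun t : k.-tuple I => f (tnth t j)) = avg f.
Proof.
move=> I0; rewrite -(avg_ffun_coord j f I0).
rewrite -(@avg_bij {ffun 'I_k -> I} _ (fun q => [tuple q j | j < k])).
  by apply: eq_avg => q; rewrite tnth_mktuple.
exists (fun t => [ffun j => tnth t j]) => [q | t].
  by apply/ffunP => l; rewrite ffunE tnth_mktuple.
by apply: eq_from_tnth => l; rewrite tnth_mktuple ffunE.
Qed.

End Average.

Section Expectation.
Variables (R : realFieldType) (S : finType).
Implicit Types (W : seq S -> R).

(* The latest sample is at the head, as in [run]. *)
Fixpoint expect (N : nat) W : R :=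
  if N is N'.+1 then expect N' (fun h => avg (fun q => W (q :: h))) else W [::].

Lemma le_expect N W W' :
  (forall h, size h = N -> W h <= W' h) -> expect N W <= expect N W'.
Proof.
elim: N W W' => [|N IH] W W' le_W /=; first exact: le_W.
by apply: IH => h hN; apply: le_avg => q; apply: le_W; rewrite /= hN.
Qed.

Lemma eq_expect N W W' :
  (forall h, size h = N -> W h = W' h) -> expect N W = expect N W'.
Proof.
by move=> e; apply/eqP; rewrite eq_le !le_expect// => h /e ->.
Qed.

Lemma expectD N W W' :
  expect N (fun h => W h + W' h) = expect N W + expect N W'.
Proof.
elim: N W W' => [|N IH] W W' //=; rewrite -IH; apply: eq_expect => h _.
exact: avgD.
Qed.

Lemma expect_sum (J : finType) N (W : J -> seq S -> R) :
  expect N (fun h => \sum_j W j h) = \sum_j expect N (W j).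
Proof.
elim: N W => [|N IH] W //=; rewrite -IH; apply: eq_expect => h _.
exact: avg_sum.
Qed.

Lemma expectZ N a W : expect N (fun h => a * W h) = a * expect N W.
Proof.
elim: N W => [|N IH] W //=; rewrite -IH; apply: eq_expect => h _.
exact: avgZ.
Qed.

Lemma expect_cst N a : (0 < #|S|)%N -> expect N (fun=> a) = a.
Proof.
move=> S0; elim: N => //= N {2}<-; apply: eq_expect => h _.
exact: avg_cst.
Qed.

Lemma expect_ge0 N W : (forall h, 0 <= W h) -> 0 <= expect N W.
Proof.
move=> W0; elim: N W W0 => [|N IH] W W0 //=; apply: IH => h.
by rewrite mulr_ge0 ?invr_ge0 ?sumr_ge0.
Qed.

(** Conditioning on the first [N] rounds: their samples [h1] stand behind the [M] newer ones. *)
Lemma expect_add M N W :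
  expect (M + N) W = expect N (fun h1 => expect M (fun h2 => W (h2 ++ h1))).
Proof. by elim: M W => [|M IH] W //=; rewrite IH. Qed.

(** Iterated contraction of a potential; the estimates for missing opinions, margins and disorder
    all rest on it. *)
Lemma expect_le_pow N W (a : R) : 0 <= a ->
  (forall h, avg (fun q => W (q :: h)) <= a * W h) ->
  expect N W <= a ^+ N * W [::].
Proof.
move=> a0 step; elim: N => [|N IH] /=; first by rewrite mul1r.
apply: le_trans (le_expect (fun h _ => step h)) _.
by rewrite expectZ exprS -mulrA ler_wpM2l.
Qed.

(** Links round-by-round averaging to the uniform distribution in [Pr]. *)
Lemma expect_tuple N W : expect N W = avg (fun h : N.-tuple S => W h).
Proof.
elim: N W => [|N IH] W /=.
  rewrite (@eq_avg _ _ _ (fun=> W [::])) => [|h]; last by rewrite tuple0.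
  by rewrite avg_cst// card_tuple.
rewrite IH -(avg_pair (fun (h : N.-tuple S) q => W (q :: h))).
pose f (p : N.-tuple S * S) : N.+1.-tuple S := cons_tuple p.2 p.1.
rewrite -(avg_bij (h := f))//.
exists (fun t => (behead_tuple t, thead t)) => [[h q] | t].
  by rewrite /f /= theadE; congr pair; apply: val_inj.
by rewrite /f /= [RHS]tuple_eta; apply: val_inj.
Qed.

End Expectation.

Lemma PrE (R : realType) (n k N : nat) (E : pred (seq (samples n k))) :
  Pr R (fun h : N.-tuple (samples n k) => E h) =
  expect N (fun h => (E h)%:R).
Proof. by rewrite expect_tuple avg_nat. Qed.

Section Indicators.
Variable R : realFieldType.

Lemma natr_or_le (a b : bool) : (a || b)%:R <= a%:R + b%:R :> R.
Proof. by case: a b => [] []; rewrite /= ?addr0 ?add0r ?lerDl ?ler01. Qed.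

Lemma natr_imp_le (a b : bool) : (a -> b) -> a%:R <= b%:R :> R.
Proof. by case: a b => [] []//= ab; rewrite ?ler01//; have := ab isT. Qed.

(** The union bound, for indicators. *)
Lemma natr_exists_le (I : finType) (P : pred I) :
  [exists i, P i]%:R <= \sum_i (P i)%:R :> R.
Proof.
case: existsP => [[i Pi] | _]; last by rewrite sumr_ge0.
by rewrite (bigD1 i)//= Pi lerDl sumr_ge0.
Qed.

End Indicators.

(** * One round of Slush *)

Section Hybrid.
Variables (R : realFieldType) (n : nat) (I : finType) (g : 'I_n -> I -> bool).
Implicit Types q : {ffun 'I_n -> I}.

Let score q := #|[set i | g i (q i)]|.
Let splice (j : nat) q q' : {ffun 'I_n -> I} :=
  [ffun i : 'I_n => if (i < j)%N then q' i else q i].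

Lemma splice0 q q' : splice 0 q q' = q.
Proof. by apply/ffunP => i; rewrite ffunE. Qed.

Lemma splicen q q' : splice n q q' = q'.
Proof. by apply/ffunP => i; rewrite ffunE ltn_ord. Qed.

(** Only coordinate [j] changes, and it can remove at most one element from the counted set. *)
Lemma score_splice j q q' :
  (score (splice j q q') <= (score (splice j.+1 q q')).+1)%N.
Proof.
case: (ltnP j n) => [jn | nj]; last first.
  rewrite (_ : splice j q q' = splice j.+1 q q') ?leqnSn//.
  apply/ffunP => i; have ij := leq_trans (ltn_ord i) nj.
  by rewrite !ffunE ij (leqW ij).
rewrite -addn1 -(cards1 (Ordinal jn)) -cardsUI.
apply: leq_trans (leq_addr _ _); apply: subset_leq_card.
apply/fintype.subsetP => i; rewrite !inE !ffunE ltnS.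
case: (ltngtP i j) => [_ ->//|_ ->//|ij _].
by rewrite -val_eqE /= ij eqxx orbT.
Qed.

(** At the least [j] with score below [b], the previous score was at least [b] and the drop is at
    most 1, so the score is exactly [b - 1]. *)
Lemma splice_crossing b q q' : (b <= score q)%N -> (score q' < b)%N ->
  [exists j : 'I_n.+1, (score (splice j q q')).+1 == b].
Proof.
move=> hq hq'; have ex : exists j, (score (splice j q q') < b)%N.
  by exists n; rewrite splicen.
case: (ex_minnP ex) => j hj minj.
have jn : (j <= n)%N by apply: minj; rewrite splicen.
apply/existsP; exists (Ordinal (jn : (j < n.+1)%N)) => /=.
case: j hj minj {jn} => [|j] hj minj; first by rewrite splice0 in hj; lia.
have := score_splice j q q'; case: (ltnP (score (splice j q q')) b) => [/minj|]; lia.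
Qed.

(** Exchanging the first [j] coordinates of a pair is an involution, so a spliced sample is uniform
    too. *)
Lemma avg_splice j (f : {ffun 'I_n -> I} -> R) : (0 < #|I|)%N ->
  avg (fun q => avg (fun q' => f (splice j q q'))) = avg f.
Proof.
move=> I0; rewrite -(avg_pair (fun q q' => f (splice j q q'))).
pose h (p : {ffun 'I_n -> I} * {ffun 'I_n -> I}) :=
  (splice j p.1 p.2, splice j p.2 p.1).
have hK : involutive h.
  by case=> q q'; apply: f_equal2; apply/ffunP => i; 
    rewrite !ffunE /=; case: ifP => ij; rewrite ?ffunE ij.
transitivity (avg (fun p => f (h p).1)); first exact: eq_avg.
rewrite (avg_bij (fun p => f p.1) (inv_bij hK)) (avg_pair (fun q _ => f q)).
by apply: eq_avg => q; rewrite avg_cst// card_ffun expn_gt0 I0.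
Qed.

(* Replacing the coordinates of a sample one by one by those of an independent
   one moves the score by steps of at most 1, so that it cannot cross a level
   without visiting it; each intermediate sample is again uniform. *)
Lemma crossing_le b : (0 < #|I|)%N ->
  avg (fun q => (b <= score q)%N%:R) * avg (fun q => (score q < b)%N%:R)
    <= n.+1%:R * avg (fun q => ((score q).+1 == b)%:R) :> R.
Proof.
move=> I0; rewrite mulrC -[X in X <= _]avgZ.
apply: (@le_trans _ _ (avg (fun q => avg (fun q' => \sum_(j < n.+1)
    ((score (splice j q q')).+1 == b)%:R)))).
  apply: le_avg => q; rewrite mulrC -avgZ; apply: le_avg => q'.
  rewrite -natrM mulnb; apply: le_trans (natr_exists_le _ _).
  by apply: natr_imp_le => /andP[]; apply: splice_crossing.
under eq_avg do rewrite avg_sum.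
rewrite avg_sum (eq_bigr (fun=> avg (fun q => ((score q).+1 == b)%:R))).
  by rewrite sumr_const card_ord mulr_natl.
by move=> j _; apply: (avg_splice j (fun q => ((score q).+1 == b)%:R)).
Qed.

End Hybrid.

Section Round.
Variables (R : realFieldType) (n k alpha : nat).
Hypotheses (hk : (2 <= k)%N) (halpha : (k < 2 * alpha)%N)
  (halphak : (alpha <= k)%N).
Variable first : arrival_rule k.
Implicit Types (c o : opinions n) (q : samples n k) (b : bool).

(** The two counts add up to at most [k < 2 * alpha], so both values cannot have a majority and the
    order of the tests in [alpha_majority] is immaterial. *)
Lemma alpha_majorityP o (t : k.-tuple 'I_n) b :
  (alpha_majority alpha o t == Some b) =
  (alpha <= count (fun j => o j == Some b) t)%N.
Proof.
rewrite /alpha_majority.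
have : (count (fun j => o j == Some true) t + count (fun j => o j == Some false) t <= k)%N.
  rewrite -count_predUI (_ : count (predI _ _) _ = 0%N).
    by rewrite addn0 -[X in (_ <= X)%N](size_tuple t) count_size.
  by apply/eqP; rewrite -leqn0 leqNgt -has_count; apply/hasPn => j _ /=; case: (o j) => [[]|].
set x := count _ _; set y := count _ _ => xy.
case: b; rewrite -/x -/y; (case: (leqP alpha x) => hx; [|case: (leqP alpha y) => hy]) => //=.
by apply/esym/negbTE; rewrite -ltnNge; lia.
Qed.

Lemma alpha_majority_all o (t : k.-tuple 'I_n) b :
  {in t, forall j, o j = Some b} -> alpha_majority alpha o t = Some b.
Proof.
move=> ot; apply/eqP; rewrite alpha_majorityP (_ : count _ _ = k)//.
rewrite -[RHS](size_tuple t); apply/eqP; rewrite -all_count.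
by apply/allP => j /ot ->.
Qed.

Definition all_active o := [forall i, o i != None].

Lemma answers_active (a : pred 'I_n) o q : all_active o -> answers first a o q = o.
Proof.
by move=> /forallP oa; apply/ffunP => i; rewrite ffunE; case: (o i) (oa i).
Qed.

(** [force], [replies] and [vote] name the stages of [slush_step], so that the counters of Blizzard
    can be read off a Slush run. *)
Definition force c o : opinions n :=
  [ffun i => if c i is Some b then Some b else o i].

Definition replies c o q : opinions n :=
  answers first (fun i => force c o i != None) (force c o) q.

Definition vote c o q (i : 'I_n) : option bool :=
  if force c o i != None then alpha_majority alpha (replies c o q) (q i)
  else None.

Lemma slush_stepE c o q i : slush_step alpha first c o q i =
  if vote c o q i is Some b then Some b else replies c o q i.
Proof.
rewrite /vote /slush_step ffunE -/(force c o) -/(replies c o q).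
case: ifP => // a; case: alpha_majority => //.
by rewrite [RHS]ffunE; case: (force c o i) a.
Qed.

Lemma force_active c o : all_active o -> all_active (force c o).
Proof.
by move=> /forallP oa; apply/forallP => i; rewrite ffunE; case: (c i).
Qed.

Lemma slush_step_active1 c o q i :
  o i != None -> slush_step alpha first c o q i != None.
Proof.
rewrite slush_stepE => oi; case: vote => //; rewrite !ffunE.
by case: (c i) => //; case: (o i) oi.
Qed.

Lemma slush_step_active c o q :
  all_active o -> all_active (slush_step alpha first c o q).
Proof.
by move=> /forallP oa; apply/forallP => i; apply: slush_step_active1.
Qed.

Lemma vote_active c o q i : all_active o ->
  vote c o q i = alpha_majority alpha (force c o) (q i).
Proof.
move=> oa; have /forallP fa := force_active c oa.
by rewrite /vote fa /replies answers_active// force_active.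
Qed.

Lemma slush_step_allactive c o q i : all_active o ->
  slush_step alpha first c o q i =
  if alpha_majority alpha (force c o) (q i) is Some b then Some b
  else force c o i.
Proof.
by move=> oa; rewrite slush_stepE vote_active// /replies answers_active// force_active.
Qed.

Lemma slush_step_unanimous c o q b : (forall i, force c o i = Some b) ->
  forall i, slush_step alpha first c o q i = Some b.
Proof.
move=> u i; have fa : all_active (force c o) by apply/forallP => j; rewrite u.
by rewrite slush_stepE /vote u /= /replies answers_active// (@alpha_majority_all _ _ b).
Qed.

(* Almost agreement with [Some b], with a bound in place of [O(sqrt n)]. *)
Definition near b o := (40 * k * #|[set i | o i != Some b]| <= n)%N.

Definition mixed o := ~~ near true o && ~~ near false o.

Lemma near_all b o : (forall i, o i = Some b) -> near b o.
Proof.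
move=> ob; rewrite /near (_ : [set _ | _] = finset.set0) ?cards0 ?muln0//.
by apply/setP => i; rewrite !inE ob eqxx.
Qed.

(** * A round in which every party has an opinion *)

Section AllActive.
Variables (F : nat) (c o : opinions n) (b : bool).
Hypotheses (hF : (40 * k * F <= n)%N) (cF : (#|[set i | c i != None]| <= F)%N).
Hypotheses (oa : all_active o) (ob : near b o).

Let bad := [set i | force c o i != Some b].

(** Old deviating parties and corrupted ones contribute at most [n / (40 k)] each; a single query
    then meets a bad party with probability at most [1 / (20 k)]. *)
Lemma force_bad : (20 * k * #|bad| <= n)%N.
Proof.
clear halpha halphak.
suff : (#|bad| <= #|[set i | o i != Some b]| + F)%N by move: ob hF; rewrite /near; nia.
apply: leq_trans (leq_add (leqnn _) cF); apply: leq_trans (leq_card_setU _ _).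
apply: subset_leq_card; apply/fintype.subsetP => i; rewrite !inE ffunE.
by case: (c i) => [?|]; rewrite ?orbT// => ->.
Qed.

Hypothesis n0 : (0 < n)%N.

Lemma card_tuple_gt0 : (0 < #|{: k.-tuple 'I_n}|)%N.
Proof. by rewrite card_tuple card_ord expn_gt0 n0. Qed.

(** A vote other than [Some b] needs a bad party among the [k] targets; union bound. *)
Lemma avg_vote_neq i :
  avg (fun q => (vote c o q i != Some b)%:R) <= 1 / 20 :> R.
Proof.
under eq_avg do rewrite vote_active//.
rewrite (avg_ffun_coord i (fun t =>
  (alpha_majority alpha (force c o) t != Some b)%:R) card_tuple_gt0).
apply: (@le_trans _ _ (avg (fun t : k.-tuple 'I_n => \sum_(j < k) (tnth t j \in bad)%:R))).
  apply: le_avg => t; apply: le_trans (natr_exists_le _ _).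
  apply: natr_imp_le; apply: contraNT; rewrite negb_exists => /forallP tb.
  apply/eqP; apply: alpha_majority_all => j /tnthP[l ->].
  by apply/eqP; have := tb l; rewrite inE negbK.
rewrite avg_sum (eq_bigr (fun=> #|bad|%:R / n%:R)) => [|j _]; last first.
  rewrite (avg_tuple_coord j (fun i => (i \in bad)%:R)) ?card_ord//.
  by rewrite (avg_nat _ (mem bad)) card_ord.
have n0' : 0 < n%:R :> R by rewrite ltr0n.
rewrite sumr_const card_ord -[_ *+ k]mulr_natl mulrA ler_pdivrMr//.
have := force_bad; rewrite -(ler_nat R) !natrM; lra.
Qed.

Let score q := #|[set i | slush_step alpha first c o q i != Some b]|.

(** Bad parties number at most [n / 40] because [k >= 2], and any other party leaves [b] with
    probability at most 1/20. *)
Lemma avg_score : avg (fun q => (score q)%:R) <= (3 / 40) * n%:R :> R.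
Proof.
have -> : avg (fun q => (score q)%:R) =
    \sum_i avg (fun q => (slush_step alpha first c o q i != Some b)%:R) :> R.
  rewrite -avg_sum; apply: eq_avg => q; rewrite -natr_sum /score -sum1dep_card.
  by rewrite big_mkcond /=; congr _%:R; apply: eq_bigr => i _; case: (_ != _).
apply: (@le_trans _ _ (\sum_(i < n) ((i \in bad)%:R + 1 / 20))).
  apply: ler_sum => i _; case: (boolP (i \in bad)) => ib.
    apply: (@le_trans _ _ (avg (fun _ : samples n k => 1))).
      by apply: le_avg => q; case: (_ != _).
    by rewrite avg_cst ?card_ffun ?expn_gt0 ?card_tuple_gt0// mulr1n; lra.
  rewrite add0r; apply: le_trans (avg_vote_neq i); apply: le_avg => q.
  apply: natr_imp_le; apply: contraNN => /eqP v.
  by rewrite slush_stepE v.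
rewrite big_split /= -natr_sum sumr_const card_ord -big_mkcond /= sum1_card.
have : 40%:R * #|bad|%:R <= n%:R :> R.
  by rewrite -natrM ler_nat; apply: leq_trans force_bad; rewrite leq_mul2r; lia.
by rewrite -[_ *+ n]mulr_natl; lra.
Qed.

(** Leaving [near b] means becoming mixed or jumping past half of the parties. By [crossing_le] a
    jump costs at most [2 n + 2] times the probability of landing just below half, which is a mixed
    state. *)
Lemma avg_not_near :
  avg (fun q => (~~ near b (slush_step alpha first c o q))%:R) <=
  (2 * n + 3)%:R * avg (fun q => (mixed (slush_step alpha first c o q))%:R) :> R.
Proof.
have S0 : (0 < #|samples n k|)%N by rewrite card_ffun expn_gt0 card_tuple_gt0.
(* For [n < 40] the bound [force_bad] leaves no bad party, and unanimity persists. *)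
have [n40 | n40] := ltnP n 40.
  have bad0 : bad = finset.set0 by apply/eqP; rewrite -cards_eq0; have := force_bad; nia.
  rewrite (@eq_avg _ _ _ (fun=> 0)) ?avg_cst// => [|q].
    by rewrite mulr_ge0// -(avg_cst 0 S0) le_avg.
  rewrite near_all//; apply: slush_step_unanimous => i; apply/eqP.
  by have := in_set0 i; rewrite -bad0 inE => /negbFE.
have mixedE o' : mixed o' = ~~ near b o' && ~~ near (~~ b) o'.
  by rewrite /mixed; case: (b) => //; rewrite andbC.
(* For [n >= 40] a score of [d - 1] is mixed, while being near [~~ b] forces a score of at least
   [d]. *)
set d := uphalf n.
have scoreN q : (#|[set i | slush_step alpha first c o q i != Some (~~ b)]| + score q = n)%N.
  rewrite -[RHS]card_ord -(cardsC [set i | slush_step alpha first c o q i != Some (~~ b)]).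
  congr addn; apply: eq_card => i; rewrite !inE.
  have /forallP/(_ i) := slush_step_active c q oa.
  by case: (slush_step _ _ _ _ _ i) => // b' _; case: (b) (b') => [] [].
have cross : avg (fun q => (d <= score q)%N%:R) <=
    (2 * n + 2)%:R * avg (fun q => ((score q).+1 == d)%:R) :> R.
  (* With all parties active, a new opinion depends on the party's own sample only, as [crossing_le]
     requires. *)
  have gE q : score q = #|[set i | (if alpha_majority alpha (force c o) (q i)
      is Some b' then Some b' else force c o i) != Some b]|.
    by apply: eq_card => i; rewrite !inE slush_step_allactive.
  have := @crossing_le R n _ (fun i t => (if alpha_majority alpha (force c o) t
    is Some b' then Some b' else force c o i) != Some b) d card_tuple_gt0.
  under eq_avg do rewrite -gE. under [X in _ * X <= _]eq_avg do rewrite -gE.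
  under [X in _ <= _ * X]eq_avg do rewrite -gE.
  set p := avg _; set p' := avg _; set r := avg _ => cr.
  have pp' : p + p' = 1.
    rewrite -avgD -[RHS](avg_cst 1 S0); apply: eq_avg => q.
    by case: ltnP => _; rewrite ?add0r ?addr0.
  have p0 : 0 <= p by rewrite -(avg_cst 0 S0) le_avg.
  (* Markov's inequality. Then [p' >= 1/2], and the crossing bound gives [p <= 2 (n + 1) r]. *)
  have p2 : p <= 1 / 2.
    have : n%:R * p <= 2 * avg (fun q => (score q)%:R) :> R.
      rewrite -!avgZ; apply: le_avg => q; case: ltnP => sd; rewrite ?mulr0 ?mulr1.
        by rewrite mulr_ge0.
      by rewrite -natrM ler_nat; move: sd; rewrite /d; lia.
    have : 0 < n%:R :> R by rewrite ltr0n.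
    have := avg_score; nra.
  have -> : (2 * n + 2)%:R = 2 * n.+1%:R :> R by rewrite -natrM; congr _%:R; lia.
  nra.
apply: (@le_trans _ _ (avg (fun q => (mixed (slush_step alpha first c o q))%:R)
     + avg (fun q => (d <= score q)%N%:R))).
  rewrite -avgD; apply: le_avg => q; apply: le_trans (natr_or_le _ _ _).
  apply: natr_imp_le => nb; rewrite mixedE nb /=.
  case: (boolP (near (~~ b) _)) => //=; rewrite /near; have := scoreN q.
  set s' := #|_| => sn ks; have : (2 * s' <= k * s')%N by rewrite leq_mul2r hk orbT.
  by rewrite /d; lia.
have : avg (fun q => ((score q).+1 == d)%:R) <=
    avg (fun q => (mixed (slush_step alpha first c o q))%:R) :> R.
  apply: le_avg => q; apply: natr_imp_le => /eqP sd; rewrite mixedE /near.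
  have := scoreN q; rewrite -/(score q); set s' := #|_|; move: sd; rewrite /d => sd s'E.
  have hk1 : (2 * score q <= k * score q)%N by rewrite leq_mul2r hk orbT.
  have hk2 : (2 * s' <= k * s')%N by rewrite leq_mul2r hk orbT.
  by rewrite -!ltnNge; apply/andP; split; lia.
set r := avg _; set r' := avg _ => rr'.
rewrite (_ : (2 * n + 3)%:R = 1 + (2 * n + 2)%:R :> R); last first.
  by rewrite -[1]/1%:R -natrD; congr _%:R; lia.
rewrite mulrDl mul1r lerD2l; apply: le_trans cross _.
by rewrite ler_wpM2l.
Qed.

End AllActive.

End Round.

(** * Runs of Slush *)

(** With [z = 1/n], Bernoulli gives [(1 + z) ^ n >= 2], hence [(1 - z) ^ n <= 1/2]; the square of
    the left side is at most 1/2, and 1/2 is below the square of 3/4. *)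
Lemma pow_one_sub_inv_le (R : realFieldType) (n m : nat) :
  (0 < n)%N -> (n <= 2 * m)%N -> (1 - n%:R^-1) ^+ m <= 3 / 4 :> R.
Proof.
move=> n0 nm; have n0' : 0 < n%:R :> R by rewrite ltr0n.
set z := n%:R^-1; have z0 : 0 < z by rewrite invr_gt0.
have z1 : z <= 1 by rewrite invf_le1// ler1n.
have bern p : 1 + p%:R * z <= (1 + z) ^+ p.
  elim: p => [|p IH]; first by rewrite mul0r addr0.
  rewrite exprS; apply: le_trans (ler_wpM2l _ IH); last lra.
  have : 0 <= p%:R :> R by []. rewrite -natr1; nra.
have y0 : 0 <= 1 - z by lra.
have hn : (1 - z) ^+ n <= 1 / 2.
  have := bern n; rewrite mulfV ?gt_eqF// => b2.
  have : (1 - z) ^+ n * (1 + z) ^+ n <= 1.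
    by rewrite -exprMn exprn_ile1//; nra.
  have : 0 <= (1 - z) ^+ n by rewrite exprn_ge0.
  nra.
have : ((1 - z) ^+ m) ^+ 2 <= 1 / 2.
  rewrite -exprM mulnC; apply: le_trans hn; apply: ler_wiXn2l => //; lra.
have : 0 <= (1 - z) ^+ m by rewrite exprn_ge0.
nra.
Qed.

(** The left side is the factor 1/2, 1 or 2 by which one vote changes [2 ^ (- margin)]; the right
    side majorizes it by a form whose average is known. *)
Lemma vote_factor (R : realFieldType) (v : option bool) (b : bool) :
  2 ^+ (v == Some (~~ b)) * 2^-1 ^+ (v == Some b) <=
  2^-1 + 3 / 2 * (v != Some b)%:R :> R.
Proof.
have -> : (v == Some (~~ b)) = (v != Some b) && (v != None).
  by case: v b => [[]|] [].
case: (v == Some b); case: (v == None); rewrite /= ?expr1 ?expr0 ?mulr0 ?mulr1 ?mul1r; lra.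
Qed.

Section Process.
Variables (n k alpha : nat).
Hypotheses (hk : (2 <= k)%N) (halpha : (k < 2 * alpha)%N)
  (halphak : (alpha <= k)%N).
Variable first : arrival_rule k.
Implicit Types (A : adversary n k) (x o : opinions n) (q : samples n k) (b : bool).
Implicit Types (h : seq (samples n k)).

(** The adversary of a run restarted after the rounds [h1], which it still remembers. *)
Definition shift A h1 : adversary n k := fun h => A (h ++ h1).

Lemma bounded_shift F A h1 : bounded F A -> bounded F (shift A h1).
Proof. by move=> bA h; apply: bA. Qed.

Lemma slush_cat A x h2 h1 : slush alpha first A x (h2 ++ h1) =
  slush alpha first (shift A h1) (slush alpha first A x h1) h2.
Proof. by rewrite /slush; elim: h2 => //= q h2 ->. Qed.

Lemma eq_slush A A' x h : A =1 A' ->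
  slush alpha first A x h = slush alpha first A' x h.
Proof. by rewrite /slush => AA'; elim: h => //= q h ->; rewrite AA'. Qed.

Lemma slush_active1 A x h i : x i != None -> slush alpha first A x h i != None.
Proof. by move=> xi; elim: h => //= q h; apply: slush_step_active1. Qed.

Lemma slush_proposes A x h :
  someone_proposes x -> someone_proposes (slush alpha first A x h).
Proof.
by move=> /existsP[i xi]; apply/existsP; exists i; apply: slush_active1.
Qed.

(* [votes A x i b h] is what [cnt[b]] of party i would be if nobody decided. *)
Fixpoint votes A x i b h : nat :=
  if h is q :: h' then
    (votes A x i b h' +
     (vote alpha first (A h') (slush alpha first A x h') q i == Some b))%N
  else 0%N.

Lemma votes_cat A x i b h2 h1 : votes A x i b (h2 ++ h1) =
  (votes (shift A h1) (slush alpha first A x h1) i b h2 + votes A x i b h1)%N.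
Proof. by elim: h2 => //= q h2 ->; rewrite slush_cat addnAC. Qed.

Lemma votes_size A x i b h : (votes A x i b h <= size h)%N.
Proof. by elim: h => //= q h IH; rewrite -addn1 leq_add ?leq_b1. Qed.

Fixpoint stay A x b h : bool :=
  [&& all_active (slush alpha first A x h), near k b (slush alpha first A x h)
    & if h is _ :: h' then stay A x b h' else true].

(* [stay], and no party comes close to deciding against [b]: the margin of its
   counters never falls to [- a]. *)
Fixpoint safe A x b a h : bool :=
  [&& all_active (slush alpha first A x h), near k b (slush alpha first A x h),
      [forall i, votes A x i (~~ b) h < votes A x i b h + a]%N
    & if h is _ :: h' then safe A x b a h' else true].

Lemma safe_stay A x b a h : safe A x b a h -> stay A x b h.
Proof. by elim: h => /= [|q h IH] /and4P[-> -> _] // /IH. Qed.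

Lemma stay_last A x b h : stay A x b h ->
  all_active (slush alpha first A x h) /\ near k b (slush alpha first A x h).
Proof. by case: h => [|q h] /and3P[]. Qed.

Hypothesis n0 : (0 < n)%N.
Variable R : realFieldType.

Let S0 : (0 < #|samples n k|)%N.
Proof. by rewrite card_ffun expn_gt0 card_tuple_gt0. Qed.

(** At least half of the parties start with an opinion and keep having one. In each round [i] stays
    without opinion only if all active parties miss it. *)
Lemma expect_bot A x b i u : near k b x ->
  expect u (fun h => (slush alpha first A x h i == None)%:R) <= (3 / 4) ^+ u :> R.
Proof.
clear halpha halphak.
move=> xb; pose W h : R := (slush alpha first A x h i == None)%:R.
suff step h : avg (fun q => W (q :: h)) <= 3 / 4 * W h.
  have p0 : 0 <= 3 / 4 :> R by lra.
  apply: le_trans (expect_le_pow u p0 step) _.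
  by rewrite ler_piMr ?exprn_ge0// /W; case: eqP.
rewrite /W /=; set o := slush alpha first A x h.
have [oi | oi] := eqVneq (o i) None; last first.
  rewrite mulr0 -[X in _ <= X](avg_cst 0 S0); apply: le_avg => q.
  by rewrite (negPf (slush_step_active1 _ _ _ _ oi)).
pose act := [set j | o j != None].
have hact : (n <= 2 * #|act|)%N.
  have : (#|[set j | x j != Some b]| + #|act| >= n)%N.
    rewrite -[X in (X <= _)%N]card_ord -(cardsC [set j | x j != Some b]) leq_add2l.
    apply: subset_leq_card; apply/fintype.subsetP => j; rewrite !inE negbK => /eqP xj.
    by apply: slush_active1; rewrite xj.
  have : (2 * #|[set j | x j != Some b]| <= k * #|[set j | x j != Some b]|)%N.
    by rewrite leq_mul2r hk orbT.
  by move: xb; rewrite /near; lia.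
have k0 : (0 < k)%N by lia.
(* Only the first target of each active party is used: the product of the [G j] is the indicator
   that none of these is [i]. *)
pose G (j : 'I_n) (t : k.-tuple 'I_n) : R :=
  if j \in act then (tnth t (Ordinal k0) != i)%:R else 1.
rewrite mulr1; apply: le_trans (pow_one_sub_inv_le R n0 hact).
apply: (@le_trans _ _ (avg (fun q : samples n k => \prod_j G j (q j)))); last first.
  rewrite avg_ffun -prodr_const [leRHS]big_mkcond /=; apply: ler_prod => j _.
  rewrite /G; case: ifP => _; last first.
    by rewrite avg_cst ?card_tuple_gt0// ler01 lexx.
  rewrite (avg_tuple_coord (Ordinal k0) (fun l => (l != i)%:R)) ?card_ord//.
  rewrite (avg_nat _ (predC1 i)) cardC1 card_ord divr_ge0//=.
  by rewrite -subn1 natrB// mulrBl mulfV ?pnatr_eq0 ?gtn_eqF// mul1r.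
apply: le_avg => q; rewrite slush_stepE.
have [jq | [j jact jq]] : (forall j, j \in act -> tnth (q j) (Ordinal k0) != i) \/
    (exists2 j, j \in act & tnth (q j) (Ordinal k0) = i).
- case: (boolP [exists j in act, tnth (q j) (Ordinal k0) == i]).
    by move=> /exists_inP[j ? /eqP]; right; exists j.
  by rewrite negb_exists_in => /forall_inP; left.
- rewrite (_ : \prod_j G j (q j) = 1) ?natr_le1// => [|]; first by case: eqP.
  by rewrite big1// => j _; rewrite /G; case: ifP => // /jq ->.
apply: (@le_trans _ _ 0); last by rewrite prodr_ge0// => l _; rewrite /G; case: ifP.
rewrite -[0]/(0%:R) ler_nat leqn0 eqb0; case: vote => //.
move: jact; rewrite inE => ja.
have : replies first (A h) o q i != None; last by [].
rewrite /replies /answers ffunE; case: (force (A h) o i) => // .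
have fj : force (A h) o j != None by rewrite ffunE; case: (A h j).
case Ej : (force (A h) o j) fj => [b'|] // _.
have rec : receives (fun j => force (A h) o j != None) (force (A h) o) q i b'.
  by apply/existsP; exists j; rewrite Ej /= eqxx -jq mem_tnth.
by case: b' rec {Ej} => ->; case: receives.
Qed.

(** * Stability and margins against a bounded adversary *)

Section Bounded.
Variables (F : nat) (A : adversary n k) (x : opinions n).
Hypotheses (hF : (40 * k * F <= n)%N) (bA : bounded F A).

(** Markov's inequality for the exponential moment [2 ^ (- margin)], set to 0 once [stay] fails so
    that the one-round bound always applies. With [e = 0] it excludes low margins, with [a = 0] it
    shows that margins grow. *)
Lemma expect_walk b i (a e m : nat) :
  expect m (fun h => (stay A x b h &&
     (votes A x i b h + a <= votes A x i (~~ b) h + e)%N)%:R)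
  <= 2 ^+ e * 2^-1 ^+ a * (3 / 5) ^+ m :> R.
Proof.
pose W h : R := (stay A x b h)%:R *
  (2 ^+ votes A x i (~~ b) h * 2^-1 ^+ votes A x i b h).
have W0 h : 0 <= W h by rewrite !mulr_ge0 ?exprn_ge0 ?invr_ge0.
have step h : avg (fun q => W (q :: h)) <= 3 / 5 * W h.
  have [sh|/negPf sh] := boolP (stay A x b h); last first.
    rewrite (@eq_avg _ _ _ (fun=> 0)) ?avg_cst// => [|q]; first by rewrite mulr_ge0//; lra.
    by rewrite /W /= sh !andbF mul0r.
  have [oa ob] := stay_last sh.
  apply: (@le_trans _ _ (avg (fun q => W h * (2^-1 + 3 / 2 *
     (vote alpha first (A h) (slush alpha first A x h) q i != Some b)%:R)))).
    apply: le_avg => q; rewrite /W /= sh mul1r.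
    set v := vote _ _ _ _ _ _.
    set st := [&& _, _ & _].
    apply: (@le_trans _ _ (2 ^+ (votes A x i (~~ b) h + (v == Some (~~ b))) *
      2^-1 ^+ (votes A x i b h + (v == Some b)))).
      by case: st; rewrite ?mul1r// mul0r mulr_ge0 ?exprn_ge0 ?invr_ge0.
    by rewrite !exprD mulrACA ler_wpM2l ?vote_factor// mulr_ge0 ?exprn_ge0// invr_ge0.
  (* The average factor is at most 1/2 + 3/2 * 1/20 = 23/40 < 3/5. *)
  rewrite avgZ avgD avg_cst// avgZ mulrC ler_wpM2r//.
  by have := avg_vote_neq R hk halpha halphak first hF (bA h) oa ob n0 i; lra.
apply: (@le_trans _ _ (2 ^+ e * 2^-1 ^+ a * expect m W)); last first.
  rewrite ler_wpM2l ?mulr_ge0 ?exprn_ge0//; try lra.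
  have p0 : 0 <= 3 / 5 :> R by lra.
  apply: le_trans (expect_le_pow m p0 step) _.
  rewrite /W /= !mulr1 ler_piMr ?exprn_ge0//; try lra.
  by case: (_ && _).
rewrite -expectZ; apply: le_expect => h _; rewrite /W.
case: stay; rewrite /= ?mul0r ?mulr0// mul1r.
case: leqP => le_t; last by rewrite !mulr_ge0 ?exprn_ge0 ?invr_ge0.
rewrite mulrACA -!exprD [(a + _)%N]addnC [(e + _)%N]addnC -(subnKC le_t).
rewrite [2 ^+ _]exprD mulrAC -exprMn (_ : 2 * 2^-1 = 1) ?expr1n ?mul1r; last by lra.
by rewrite exprn_ege1//; lra.
Qed.

(** Safety first fails in a round either by leaving [near b], which [avg_not_near] charges to mixed
    states, or because some margin falls to [- a]. *)
Lemma expect_unsafe b (a m : nat) :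
  (0 < a)%N -> all_active x -> near k b x ->
  expect m (fun h => (~~ safe A x b a h)%:R) <=
  \sum_(t < m) ((2 * n + 3)%:R * expect t.+1 (fun h => (mixed k (slush alpha first A x h))%:R)
     + n%:R * 2^-1 ^+ a) :> R.
Proof.
move=> a0 xa xb; elim: m => [|m IH].
  rewrite big_ord0 /= xa xb /=; set P := FiniteQuant.quant0b _.
  by have -> : P by apply/forallP => i.
rewrite big_ord_recr /=.
apply: (@le_trans _ _ (expect m (fun h => (~~ safe A x b a h)%:R) +
  (2 * n + 3)%:R * expect m.+1 (fun h => (mixed k (slush alpha first A x h))%:R) +
  \sum_(i < n) expect m.+1 (fun h => (stay A x b h &&
     (votes A x i b h + a <= votes A x i (~~ b) h + 0)%N)%:R))); last first.
  rewrite -addrA lerD// lerD//.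
  apply: (@le_trans _ _ (\sum_(i < n) 2^-1 ^+ a)); last first.
    by rewrite sumr_const card_ord mulr_natl.
  apply: ler_sum => i _; apply: le_trans (expect_walk b i a 0 m.+1) _.
  rewrite mul1r ler_piMr ?exprn_ge0 ?exprn_ile1//; lra.
rewrite -expectZ -expect_sum -expectD /= -expectD.
apply: le_expect => h _; rewrite avg_sum.
have [sh | ush] := boolP (safe A x b a h); last first.
  rewrite [X in X <= _](_ : _ = 1); last first.
    by rewrite -[RHS](avg_cst 1 S0); apply: eq_avg => q; rewrite !andbF.
  rewrite -!addrA -[X in X <= _]addr0 lerD// addr_ge0//.
    by rewrite -(avg_cst 0 S0) le_avg// => q; rewrite mulr_ge0.
  by rewrite sumr_ge0// => i _; rewrite -(avg_cst 0 S0) le_avg.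
have [oa ob] := stay_last (safe_stay sh).
rewrite add0r avgZ.
apply: le_trans (lerD (avg_not_near R hk halpha halphak first hF (bA h) oa ob n0) (lexx _)).
rewrite -avg_sum -avgD; apply: le_avg => q.
rewrite (safe_stay sh) !andbT slush_step_active//=.
case: near => /=; last by rewrite lerDl sumr_ge0.
rewrite add0r; apply: le_trans (natr_exists_le _ _); apply: natr_imp_le.
rewrite negb_forall => /existsP[i ?]; apply/existsP; exists i.
by rewrite addn0 leqNgt.
Qed.

End Bounded.
End Process.

(** * Coupling of Blizzard with Slush *)

Section Coupling.
Variables (n k alpha tau : nat).
Hypotheses (hk : (2 <= k)%N) (halpha : (k < 2 * alpha)%N)
  (halphak : (alpha <= k)%N).
Variable first : arrival_rule k.
Variables (A : adversary n k) (x : opinions n).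
Implicit Types (o : opinions n) (q : samples n k) (b : bool).
Implicit Types (h : seq (samples n k)).

Local Notation slush_at h := (slush alpha first A x h).
Local Notation blizzard_at h := (blizzard alpha tau first A x h).
Local Notation votes_at i b h := (votes alpha first A x i b h).

Definition blizzard_force (c : {ffun 'I_n -> option bool}) (s : 'I_n -> party) :
    opinions n :=
  [ffun i => if undecided (s i) then
               if c i is Some b then Some b else opinion (s i)
             else opinion (s i)].

Lemma decide_early (p : party) : (forall b, cnt p b < tau)%N -> decide tau p = p.
Proof.
move=> p_tau; rewrite /decide; case: undecided => //=.
have := p_tau true; have := p_tau false.
by case: eqP => [?|_]; [lia|case: eqP => [?|//]; lia].
Qed.

Lemma decide_toward b (p : party) :
  undecided p -> (cnt p (~~ b) < cnt p b + tau)%N ->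
  decide tau p = if cnt p b == (cnt p (~~ b) + tau)%N
    then Party (opinion p) (cnt p) (rcons (decided p) b) else p.
Proof.
rewrite /decide => -> /=; case: b => /= lt_b.
  by case: eqP => // _; case: eqP => // e; rewrite e ltnn in lt_b.
by case: eqP => // e; rewrite e ltnn in lt_b.
Qed.

(** Fewer than [tau] rounds cannot bring a counter to [tau], so nobody decides and Blizzard
    coincides with Slush. *)
Lemma blizzard_early h : (size h < tau)%N -> forall i,
  [/\ decided (blizzard_at h i) = [::], opinion (blizzard_at h i) = slush_at h i &
      forall b, cnt (blizzard_at h i) b = votes_at i b h].
Proof.
elim: h => [|q h IH] //= hh i; have {}IH := IH (ltnW hh).
rewrite /blizzard /= -/(blizzard_at h) /blizzard_step.
set s := blizzard_at h in IH *; set c := A h.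
have und j : undecided (s j) by rewrite /undecided; have [->] := IH j.
rewrite -/(blizzard_force c s).
have -> : blizzard_force c s = force c (slush_at h).
  by apply/ffunP => j; rewrite !ffunE und; have [_ -> _] := IH j.
have -> : (fun j => undecided (s j) && (force c (slush_at h) j != None)) =
    (fun j => force c (slush_at h) j != None).
  by apply/funext => j; rewrite und.
rewrite -/(replies first c (slush_at h) q).
have [-> _ cE] := IH i; rewrite und /=.
set p := (X in decide tau X).
have pE : [/\ decided p = [::], opinion p = slush_at (q :: h) i &
      forall b, cnt p b = votes_at i b (q :: h)].
  rewrite [slush_at (q :: h)]/(slush_step alpha first c (slush_at h) q) slush_stepE.
  rewrite /= -/c /p /vote; case fi: (force c (slush_at h) i != None); rewrite ?fi;
    last by split=> // b; rewrite cE addn0.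
  case: alpha_majority => [b|].
    by split=> // b'; rewrite /= cE -[RHS]/(_ + _)%N [b' == b]eq_sym.
  split=> //= [|b]; last by rewrite cE addn0.
  by rewrite /replies [RHS]ffunE; case: (force _ _ i) fi.
have [pd po pc] := pE; rewrite decide_early// => b; rewrite pc.
exact: (leq_ltn_trans (votes_size alpha first A x i b (q :: h)) hh).
Qed.

(* As long as decisions are only made for [b], freezing a party can only help
   [b]: Blizzard run on the same samples stays ahead of Slush. *)
Definition ahead b h (i : 'I_n) : Prop :=
  let p := blizzard_at h i in
  [/\ decided p = [::], (votes_at i b h + cnt p (~~ b) <= cnt p b + votes_at i (~~ b) h)%N,
      (cnt p b < cnt p (~~ b) + tau)%N, opinion p != None &
      slush_at h i = Some b -> opinion p = Some b]
  \/ decided p = [:: b] /\ opinion p = Some b.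

Lemma ahead_early b h i : (size h < tau)%N -> all_active (slush_at h) -> ahead b h i.
Proof.
move=> hh /forallP oa; have [d o c] := blizzard_early hh i; left.
rewrite d o !c addnC; split=> //; have := votes_size alpha first A x i b h; lia.
Qed.

Lemma neq_someN (u : option bool) b : u != None -> (u == Some (~~ b)) = (u != Some b).
Proof. by case: u b => [[]|] []. Qed.

(** Decided parties hold [b], so whoever holds [b] in Slush holds it in Blizzard. Votes for [b] thus
    carry over to Blizzard and votes against it back to Slush; the bound on the Slush margin then
    excludes decisions against [b]. *)
Lemma ahead_step b q h : all_active (slush_at h) -> (forall i, ahead b h i) ->
  (forall i, votes_at i (~~ b) (q :: h) < votes_at i b (q :: h) + tau)%N ->
  forall i, ahead b (q :: h) i.
Proof.
move=> oa ah tq i; have := tq i; rewrite /ahead /= in ah.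
rewrite /ahead [slush_at (q :: h)]/(slush_step alpha first (A h) (slush_at h) q).
rewrite /= /blizzard /= -/(blizzard_at h) /blizzard_step.
set s := blizzard_at h in ah *; set c := A h.
rewrite -/(blizzard_force c s); set oB := blizzard_force c s.
set o := slush_at h; set oS := force c o.
have /forallP oSa : all_active oS by apply: force_active.
have oBd j : ~~ undecided (s j) -> oB j = Some b.
  by rewrite ffunE /undecided; have [[-> //]|[-> ->]] := ah j.
have oBa : all_active oB.
  apply/forallP => j; rewrite ffunE /undecided.
  by have [[-> _ _ oj _]|[-> ->]] := ah j; rewrite /=; case: (c j).
have dom j : oS j = Some b -> oB j = Some b.
  rewrite ffunE => e; case: (boolP (undecided (s j))) => [u|/oBd//].
  move: e; rewrite [oB j]ffunE u; case: (c j) => // e.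
  by have [[_ _ _ _ ->]|[_ ->]] := ah j.
have domN j : oB j == Some (~~ b) -> oS j == Some (~~ b).
  rewrite !neq_someN ?(forallP oBa)//; apply: contraNN => /eqP /dom ->; exact: eqxx.
rewrite (answers_active _ _ _ oBa) slush_step_allactive// vote_active// -/oS.
set vS := alpha_majority alpha oS (q i); set vB := alpha_majority alpha oB (q i).
have vb : vS = Some b -> vB = Some b.
  move/eqP; rewrite alpha_majorityP// => le_a; apply/eqP.
  rewrite alpha_majorityP//; apply: leq_trans le_a _; apply: sub_count => j /= /eqP.
  by move=> /dom ->.
have vbN : vB = Some (~~ b) -> vS = Some (~~ b).
  move/eqP; rewrite alpha_majorityP// => le_a; apply/eqP.
  by rewrite alpha_majorityP//; apply: leq_trans le_a _; apply: sub_count.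
case: (boolP (undecided (s i))) => [u|du]; last first.
  move=> _; right; rewrite /decide /= du -/(oB i) oBd//.
  by have [[d]|[-> _]] := ah i; rewrite // /undecided d in du.
rewrite (forallP oBa) /=.
have [[sd sc sl _ _]|[d _]] := ah i; last by rewrite /undecided d in u.
rewrite sd -/o; set p := (X in decide tau X) => tqi.
have pd : undecided p by rewrite /p; case: (vB).
have pd' : decided p = [::] by apply/eqP.
have cp b' : cnt p b' = (cnt (s i) b' + (vB == Some b'))%N.
  by rewrite /p; case: (vB) => [b''|] /=; rewrite ?addn0 1?eq_sym.
have op : opinion p = if vB is Some b' then Some b' else oB i by rewrite /p; case: (vB).
(* The margin gains at least as much in Blizzard as in Slush, written without subtraction. *)
have vv : ((vS == Some b) + (vB == Some (~~ b)) <= (vB == Some b) + (vS == Some (~~ b)))%N.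
  clear - vb vbN; move: vb vbN; case: vS vB b => [[]|] [[]|] [] //= vb vbN; try by have := vb erefl.
    by have := vbN erefl.
  by have := vbN erefl.
have tc : (votes_at i b h + (vS == Some b) + cnt p (~~ b) <=
    cnt p b + (votes_at i (~~ b) h + (vS == Some (~~ b))))%N.
  by rewrite !cp; lia.
rewrite (@decide_toward b)//; last by lia.
case: eqP => cpb; [right | left; split=> //].
- rewrite /= pd' op; split => //.
  (* The difference was below [tau] before, so only a vote for [b] can have completed it. *)
  suff /eqP -> : vB == Some b by [].
  by move: cpb; rewrite !cp; case: eqP => // _; lia.
- by move: cpb; rewrite !cp; have := leq_b1 (vB == Some b); lia.
- by rewrite op; case: (vB) => //; apply: (forallP oBa).
- rewrite op; case Es: (vS) => [b'|]; first by move=> eb; rewrite vb// Es.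
  move: vbN; case Eb: (vB) => [b'|] vbN; last exact: dom.
  by case: (eqVneq b' b) => [->//|nb]; have := vbN;
    rewrite Es; case: (b') (b) nb => [] [] // _ /(_ erefl).
Qed.

(** The rounds [h1] shift a margin by at most [size h1] either way, whence the allowances
    [tau - size h1] and [tau + size h1]. A final Slush margin of [tau] contradicts the undecided
    case of [ahead]. *)
Lemma blizzard_decides b (h2 h1 : seq (samples n k)) :
  (size h1 < tau)%N ->
  safe alpha first (shift A h1) (slush_at h1) b (tau - size h1) h2 ->
  (forall i, votes alpha first (shift A h1) (slush_at h1) i (~~ b) h2 + tau + size h1 <=
       votes alpha first (shift A h1) (slush_at h1) i b h2)%N ->
  forall i, decided (blizzard_at (h2 ++ h1) i) = [:: b].
Proof.
move=> hs sf hi i.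
have : forall i, ahead b (h2 ++ h1) i.
  elim: h2 {hi} sf => [|q h2 IH] sf.
    by move=> j; apply: ahead_early => //; case/and4P: sf.
  have /and4P[_ _ /forallP lo sf2] := sf.
  apply: ahead_step; last 2 first => //.
  - exact: IH.
  - move=> j; have := lo j; rewrite -cat_cons !votes_cat.
    by have := votes_size alpha first A x j (~~ b) h1; lia.
  - by rewrite slush_cat; have [] := stay_last (safe_stay sf2).
move=> /(_ i)[[_ tc sl _ _]|[]//].
have := hi i; rewrite !votes_cat in tc.
by have := votes_size alpha first A x i (~~ b) h1; lia.
Qed.

Lemma consensus_of_decided b (s : 'I_n -> party) :
  (forall i, decided (s i) = [:: b]) ->
  (forall b', (forall i, x i = Some b') -> b' = b) -> consensus x s.
Proof.
move=> sb xb; apply/and4P; split.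
- by apply/forallP => i; rewrite sb.
- apply/forallP => b'; apply/implyP => /forallP u; apply/forallP => i.
  by rewrite sb (xb b') ?mem_head// => j; apply/eqP.
- by apply/forallP => i; rewrite sb.
- by apply/forallP => i; apply/forallP => j; rewrite !sb /= eqxx.
Qed.

End Coupling.

(** * Bounds for a fixed number of parties *)

Section Numeric.
Variable R : realFieldType.

Lemma natr_mul_sum (n : nat) (c : R) : n%:R * c = \sum_(i < n) c.
Proof. by rewrite sumr_const card_ord mulr_natl. Qed.

Lemma half_pow_le (T s : nat) : (s <= T + T./2)%N ->
  2^-1 ^+ (2 * T - s) <= (3 / 4) ^+ T./2 :> R.
Proof.
move=> sT; apply: (@le_trans _ _ (2^-1 ^+ T./2)).
  by apply: ler_wiXn2l; [lra | lra | lia].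
by rewrite lerXn2r ?nnegrE//; lra.
Qed.

(** This is where [7 * T] rounds suffice. The worst case is [s = T + u], with exponents [4 u + 3 v]
    and [5 u + 6 v]; here [2^4 (3/5)^5 * 2^3 (3/5)^6 < 3/4], and the surplus [v - u] only adds
    factors below 1. *)
Lemma walk_pow_le (T s : nat) : (s <= T + T./2)%N ->
  2 ^+ (2 * T + s) * (3 / 5) ^+ (7 * T - s) <= (3 / 4) ^+ T./2 :> R.
Proof.
move=> sT; set u := T./2 in sT *; pose v := (T - u)%N.
have uv : (u <= v)%N by rewrite /v /u; lia.
have Tuv : T = (u + v)%N by rewrite /v /u; lia.
apply: (@le_trans _ _ (2 ^+ (4 * u + 3 * v) * (3 / 5) ^+ (5 * u + 6 * v))).
  apply: ler_pM; rewrite ?exprn_ge0//; first lra.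
    by apply: ler_weXn2l; [lra | lia].
  by apply: ler_wiXn2l; [lra | lra | lia].
apply: (@le_trans _ _ ((2 ^+ 4 * (3 / 5) ^+ 5) ^+ u * (2 ^+ 3 * (3 / 5) ^+ 6) ^+ v)).
  have -> // (a c : R) : a ^+ (4 * u + 3 * v) * c ^+ (5 * u + 6 * v) =
      (a ^+ 4 * c ^+ 5) ^+ u * (a ^+ 3 * c ^+ 6) ^+ v.
  by rewrite (exprD a (4 * u)) (exprD c (5 * u)) mulrACA 4!exprM -!exprMn.
apply: (@le_trans _ _ ((2 ^+ 4 * (3 / 5) ^+ 5) ^+ u * (2 ^+ 3 * (3 / 5) ^+ 6) ^+ u)).
  rewrite ler_wpM2l ?exprn_ge0//; first lra.
  by apply: ler_wiXn2l => //; lra.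
by rewrite -exprMn lerXn2r ?nnegrE//; lra.
Qed.

End Numeric.

Section Finite.
Variables (n k alpha : nat).
Hypotheses (hk : (2 <= k)%N) (halpha : (k < 2 * alpha)%N)
  (halphak : (alpha <= k)%N).
Variable first : arrival_rule k.
Implicit Types (A : adversary n k) (x o : opinions n) (q : samples n k) (b : bool).
Implicit Types (h : seq (samples n k)).
Hypothesis n0 : (0 < n)%N.
Variable R : realFieldType.

Let S0 : (0 < #|samples n k|)%N.
Proof. by rewrite card_ffun expn_gt0 card_tuple_gt0. Qed.

(** * Convergence to unanimity without an adversary *)

Definition unanimous o := [exists b : bool, [forall i, o i == Some b]].

(** A potential that is at least 1 off unanimity, and at least halves when unanimity is reached or a
    party gains an opinion. *)
Definition disorder o : R := if unanimous o then 0 else 2 ^+ #|[set i | o i == None]|.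

Lemma unanimous_step o q : unanimous o -> unanimous (slush_step alpha first [ffun=> None] o q).
Proof.
move=> /existsP[b /forallP ob]; apply/existsP; exists b; apply/forallP => i.
by apply/eqP; apply: slush_step_unanimous => // j; rewrite !ffunE; apply/eqP.
Qed.

Lemma force_idle o : force [ffun=> None] o = o.
Proof. by apply/ffunP => i; rewrite !ffunE. Qed.

Lemma disorder_le_half o o' :
  unanimous o' || ([set i | o' i == None] \proper [set i | o i == None]) ->
  ~~ unanimous o -> disorder o' <= 2^-1 * disorder o.
Proof.
rewrite /disorder; case: ifP => /= [_ _ _|_ pr /negPf ->].
  by case: ifP; rewrite mulr_ge0 ?invr_ge0 ?exprn_ge0.
rewrite ler_pdivlMl// -exprS; apply: ler_weXn2l; first by lra.
exact: proper_card.
Qed.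

(* Either all queries go to one fixed active party, or, if some party has no
   opinion yet, all go to that party. *)
Lemma disorder_good_sample o : someone_proposes o -> ~~ unanimous o ->
  exists q, disorder (slush_step alpha first [ffun=> None] o q) <= 2^-1 * disorder o.
Proof.
move=> /existsP[i oi] nu.
pose q (j : 'I_n) : samples n k := [ffun=> nseq_tuple k j].
have [oa|] := boolP (all_active o).
  exists (q i); apply: disorder_le_half => //; apply/orP; left.
  case Ei: (o i) oi => [b|]// _; apply/existsP; exists b; apply/forallP => j.
  rewrite slush_step_allactive// force_idle (@alpha_majority_all _ _ _ hk halpha halphak _ _ b)//.
  by move=> l; rewrite ffunE => /nseqP[-> _].
rewrite negb_forall => /existsP[j]; rewrite negbK => oj.
exists (q j); apply: disorder_le_half => //; apply/orP; right; apply/properP; split.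
  apply/fintype.subsetP => l; rewrite !inE; apply: contraLR => ol.
  exact: slush_step_active1.
exists j; rewrite !inE//.
rewrite slush_stepE; case: vote => //.
rewrite /replies force_idle ffunE (eqP oj).
case Ei: (o i) oi => [b|]// _.
have rec : receives (fun l => o l != None) o (q j) j b.
  apply/existsP; exists i; rewrite Ei eqxx /= ffunE.
  by apply/nseqP; split=> //; lia.
by case: b rec {Ei} => ->; case: receives.
Qed.

Lemma disorder_step o q : disorder (slush_step alpha first [ffun=> None] o q) <= disorder o.
Proof.
rewrite /disorder; have [u|nu] := boolP (unanimous o); first by rewrite unanimous_step.
case: ifP => _; first by rewrite exprn_ge0.
apply: ler_weXn2l; first lra.
apply: subset_leq_card; apply/fintype.subsetP => l; rewrite !inE; apply: contraLR => ol.
exact: slush_step_active1.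
Qed.

(** One of the [M] equally likely samples halves the disorder and none increases it, so it shrinks
    on average by [1 - 1 / (2 M)], from at most [2 ^ n]. *)
Lemma expect_mixed_idle A x t : bounded 0 A -> someone_proposes x ->
  expect t (fun h => (mixed k (slush alpha first A x h))%:R) <=
  2 ^+ n * (1 - (2 * #|samples n k|%:R)^-1) ^+ t :> R.
Proof.
move=> bA xp.
have A0 h : A h = [ffun=> None].
  have := bA h; rewrite leqn0 cards_eq0 => /eqP a0; apply/ffunP => i; rewrite ffunE.
  by apply/eqP; have := in_set0 i; rewrite -a0 inE => /negbFE.
have S0' : 0 < #|samples n k|%:R :> R by rewrite ltr0n.
have S1' : 1 <= #|samples n k|%:R :> R by rewrite ler1n.
set M : R := #|samples n k|%:R in S0' S1' *.
have lam0 : 0 <= 1 - (2 * M)^-1.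
  by rewrite subr_ge0 invf_le1 ?mulr_gt0//; lra.
apply: (@le_trans _ _ (expect t (fun h => disorder (slush alpha first A x h)))).
  apply: le_expect => h _; rewrite /disorder; case: ifP => [/existsP[b /forallP u]|_].
    have nb : near k b (slush alpha first A x h) by apply: near_all => i; apply/eqP.
    by rewrite /mixed; case: b nb {u} => ->; rewrite ?andbF.
  by apply: (@le_trans _ _ 1); [case: mixed | apply: exprn_ege1; lra].
apply: le_trans (expect_le_pow t lam0 _) _; last first.
  rewrite mulrC ler_wpM2r ?exprn_ge0//= /disorder; case: ifP => _; first by rewrite exprn_ge0.
  apply: ler_weXn2l; first lra.
  by rewrite -[X in (_ <= X)%N]card_ord max_card.
move=> h; set o := slush alpha first A x h.
rewrite (_ : avg _ =
    avg (fun q => disorder (slush_step alpha first [ffun=> None] o q))); last first.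
  by rewrite -(A0 h).
have op : someone_proposes o by apply: slush_proposes.
have [u|nu] := boolP (unanimous o).
  rewrite (@eq_avg _ _ _ (fun=> 0)) => [|q]; first by rewrite avg_cst// /disorder u mulr0.
  by rewrite /disorder unanimous_step.
have [q0 hq0] := disorder_good_sample op nu.
rewrite /avg (bigD1 q0)//= ler_pdivrMr//.
apply: (@le_trans _ _ (2^-1 * disorder o + \sum_(q | q != q0) disorder o)).
  by rewrite lerD// ler_sum// => q _; apply: disorder_step.
have -> : \sum_(q | q != q0) disorder o = (M - 1) * disorder o.
  by rewrite sumr_const cardC1 -[_ *+ _]mulr_natl -subn1 natrB.
rewrite -mulrDl mulrAC ler_wpM2r//.
  by rewrite /disorder; case: ifP => _ //; rewrite exprn_ge0.
by rewrite mulrBl mul1r invfM mulfVK ?gt_eqF//; lra.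
Qed.

(** * From almost agreement in Slush to consensus in Blizzard *)

Section Bound.
Variables (F T : nat) (delta : R).
Hypothesis hF : (40 * k * F <= n)%N.
Hypothesis slush_mixed : forall x A, someone_proposes x -> bounded F A ->
  expect T (fun h => (mixed k (slush alpha first A x h))%:R) <= delta.

(** Restart at round [t - T]: [delta] is uniform over initial states and adversaries, and both
    assumptions survive the restart. *)
Lemma mixed_late x A t : (T <= t)%N -> someone_proposes x -> bounded F A ->
  expect t (fun h => (mixed k (slush alpha first A x h))%:R) <= delta.
Proof.
move=> /subnKC <- xp bA; rewrite expect_add -[leRHS](expect_cst (t - T) delta S0).
apply: le_expect => h1 _; under eq_expect do rewrite slush_cat.
exact: slush_mixed (slush_proposes _ _ _ _ xp) (bounded_shift h1 bA).
Qed.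

(* From a unanimous start the adversary can idle without any effect, so that
   the state at an early round is also a possible state at round T. *)
Lemma mixed_unanimous x A b t : (forall i, x i = Some b) -> bounded F A ->
  expect t (fun h => (mixed k (slush alpha first A x h))%:R) <= delta.
Proof.
move=> xb bA; have xp : someone_proposes x.
  by apply/existsP; exists (Ordinal n0); rewrite xb.
have [Tt|/ltnW tT] := leqP T t; first exact: mixed_late.
pose d := (T - t)%N.
(* After [d] idle rounds [A'] plays [A] with these rounds hidden; as the latest sample comes first,
   [take] drops the oldest. *)
pose A' : adversary n k := fun h =>
  if (size h < d)%N then [ffun=> None] else A (take (size h - d) h).
have bA' : bounded F A'.
  move=> h; rewrite /A'; case: ifP => _; last exact: bA.
  by rewrite (_ : [set _ | _] = finset.set0) ?cards0//; apply/setP => i; rewrite !inE ffunE eqxx.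
have idle h : (size h <= d)%N -> slush alpha first A' x h = x.
  elim: h => [//|q h IH] hd.
  rewrite [LHS]/(slush_step alpha first (A' h) (slush alpha first A' x h) q).
  rewrite IH ?(ltnW hd)//; apply/ffunP => i; rewrite xb; apply: slush_step_unanimous => // j.
  by rewrite !ffunE /A' hd ffunE xb.
have := slush_mixed xp bA'; rewrite -(subnKC tT) -/d expect_add.
rewrite (@eq_expect _ _ _ _ (fun=> expect t (fun h => (mixed k (slush alpha first A x h))%:R))).
  by rewrite expect_cst.
move=> h1 h1d; apply: eq_expect => h2 _; rewrite slush_cat idle ?h1d//.
rewrite (@eq_slush _ _ _ _ _ A)// => h.
by rewrite /shift /A' size_cat h1d ltnNge leq_addl /= addnK take_size_cat.
Qed.

(** After [h1], consensus fails only if safety fails, which costs the first two terms, or if some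
    final margin does not exceed [2 T + size h1], which costs the last. *)
Lemma expect_not_consensus_from x A b (m : nat) (h1 : seq (samples n k)) :
  bounded F A -> (size h1 < 2 * T)%N ->
  all_active (slush alpha first A x h1) -> near k b (slush alpha first A x h1) ->
  (forall b', (forall i, x i = Some b') -> b' = b) ->
  expect m (fun h => (~~ consensus x (blizzard alpha (2 * T) first A x (h ++ h1)))%:R) <=
  (2 * n + 3)%:R * \sum_(t < m)
    expect t.+1 (fun h => (mixed k (slush alpha first A x (h ++ h1)))%:R)
  + m%:R * n%:R * 2^-1 ^+ (2 * T - size h1)
  + n%:R * (2 ^+ (2 * T + size h1) * (3 / 5) ^+ m) :> R.
Proof.
move=> bA hs xa xb xv; set s := size h1 in hs *.
set A' := shift A h1; set x' := slush alpha first A x h1 in xa xb.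
pose high h := [forall i, votes alpha first A' x' i (~~ b) h + 2 * T + s <=
  votes alpha first A' x' i b h]%N.
have bA' : bounded F A' by apply: bounded_shift.
have a0 : (0 < 2 * T - s)%N by rewrite subn_gt0.
apply: (@le_trans _ _ (expect m (fun h => (~~ safe alpha first A' x' b (2 * T - s) h)%:R) +
  \sum_(i < n) expect m (fun h => (stay alpha first A' x' b h &&
    (votes alpha first A' x' i b h + 0 <=
     votes alpha first A' x' i (~~ b) h + (2 * T + s))%N)%:R))).
  rewrite -expect_sum -expectD; apply: le_expect => h _.
  have [sf|/=] := boolP (safe alpha first A' x' b (2 * T - s) h); last first.
    by move=> _; rewrite -[leLHS]addr0 lerD ?sumr_ge0//; case: consensus.
  rewrite add0r; apply: le_trans (natr_exists_le _ _); apply: natr_imp_le.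
  apply: contraNT; rewrite negb_exists => /forallP hi.
  apply: (@consensus_of_decided _ _ b) => // i.
  apply: (blizzard_decides hk halpha halphak hs sf) => j.
  by have := hi j; rewrite (safe_stay sf) /= -ltnNge addn0 addnA; apply: ltnW.
apply: lerD; last first.
  rewrite natr_mul_sum.
  apply: ler_sum => i _.
  apply: le_trans (expect_walk hk halpha halphak first n0 R x' hF bA' b i 0 _ m) _.
  by rewrite expr0 mulr1.
have eX t : expect t (fun h => (mixed k (slush alpha first A x (h ++ h1)))%:R) =
    expect t (fun h => (mixed k (slush alpha first A' x' h))%:R) :> R.
  by apply: eq_expect => h _; rewrite slush_cat.
apply: le_trans (expect_unsafe hk halpha halphak first n0 R hF bA' m a0 xa xb) _.
rewrite big_split -mulr_sumr -mulrA (natr_mul_sum m).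
by under [in leRHS]eq_bigr do rewrite eX.
Qed.

Hypothesis T0 : (0 < T)%N.

(** A unanimous start is treated from round 0. Otherwise the first [T + T./2] rounds, too few for a
    decision, bring almost agreement and then an opinion for everybody. *)
Lemma expect_not_consensus x A : someone_proposes x -> bounded F A ->
  expect (7 * T) (fun h => (~~ consensus x (blizzard alpha (2 * T) first A x h))%:R) <=
  (1 + n + 7 * T * (2 * n + 3))%:R * delta + (n * (7 * T + 2))%:R * (3 / 4) ^+ T./2 :> R.
Proof.
move=> xp bA; set u := T./2; set p := (3 / 4) ^+ u.
have p0 : 0 <= p by rewrite exprn_ge0//; lra.
have d0 : 0 <= delta by apply: le_trans (slush_mixed xp bA); apply: expect_ge0.
have N0 (j : nat) : 0 <= j%:R :> R by [].
(* The estimate shared by both cases, for [m] rounds after a prefix of [s] rounds. *)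
have tail (m s : nat) X : (m + s = 7 * T)%N -> (s <= T + u)%N -> X <= m%:R * delta ->
   (2 * n + 3)%:R * X + m%:R * n%:R * 2^-1 ^+ (2 * T - s)
    + n%:R * (2 ^+ (2 * T + s) * (3 / 5) ^+ m) <=
   (7 * T * (2 * n + 3))%:R * delta + (n * (7 * T + 1))%:R * p.
  move=> ms su hX; have mE : m = (7 * T - s)%N by lia.
  have m7 : m%:R <= (7 * T)%:R :> R by rewrite ler_nat mE leq_subr.
  have h1 := half_pow_le R su; have h2 := walk_pow_le R su; rewrite -mE -/p in h2.
  rewrite -/p in h1.
  apply: (@le_trans _ _ ((2 * n + 3)%:R * ((7 * T)%:R * delta) + (7 * T)%:R * n%:R * p + n%:R * p)).
    apply: lerD; last by rewrite ler_wpM2l.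
    apply: lerD.
      by rewrite ler_wpM2l// (le_trans hX)// ler_wpM2r.
    apply: ler_pM => //; first by rewrite mulr_ge0.
      by rewrite exprn_ge0// invr_ge0.
    by rewrite ler_wpM2r.
  rewrite le_eqVlt; apply/orP; left; apply/eqP; ring.
have [/existsP[b /forallP xb]|nu] := boolP (unanimous x).
  have xb' i : x i = Some b by apply/eqP.
  have xa : all_active x by apply/forallP => i; rewrite xb'.
  have xv b' : (forall i, x i = Some b') -> b' = b.
    by move=> /(_ (Ordinal n0)); rewrite xb' => -[].
  rewrite (@eq_expect _ _ _ _ (fun h => (~~ consensus x
      (blizzard alpha (2 * T) first A x (h ++ [::])))%:R)); last first.
    by move=> h _; rewrite cats0.
  apply: le_trans (@expect_not_consensus_from x A b _ [::] bA _ xa (near_all _ xb') xv) _.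
    by rewrite /=; lia.
  apply: le_trans (tail (7 * T)%N 0%N _ _ _ _) _; rewrite ?addn0//.
    rewrite natr_mul_sum ler_sum// => t _.
    under eq_expect do rewrite cats0.
    exact: mixed_unanimous xb' bA.
  apply: lerD; rewrite ler_wpM2r// ler_nat; last by rewrite leq_mul2l; lia.
  by rewrite leq_addl.
pose s := (u + T)%N; pose m := (7 * T - s)%N.
have ms : (m + s = 7 * T)%N by rewrite /m /s /u; lia.
have sT : (s < 2 * T)%N by rewrite /s /u; lia.
(* The proposals are not unanimous, so validity permits either value. *)
have xv b b' : (forall i, x i = Some b') -> b' = b.
  move=> xb; case/negP: nu; apply/existsP; exists b'; apply/forallP => i.
  by rewrite xb.
(* At round [T] the state is mixed, or it is near some value and [expect_bot] covers the next [u]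
   rounds. *)
have bot i : expect s (fun h => (slush alpha first A x h i == None)%:R) <= delta + p.
  rewrite /s expect_add.
  apply: (@le_trans _ _ (expect T (fun h => (mixed k (slush alpha first A x h))%:R + p))).
    apply: le_expect => h _; under eq_expect do rewrite slush_cat.
    case: (boolP (mixed _ _)) => [_|mx].
      apply: (@le_trans _ _ 1); last by rewrite lerDl.
      by rewrite -[leRHS](expect_cst u 1 S0) le_expect// => h2 _; case: eqP.
    have [b nb] : exists b, near k b (slush alpha first A x h).
      by move: mx; rewrite /mixed negb_and !negbK => /orP[]; eexists; eassumption.
    by rewrite add0r; apply: (expect_bot alpha hk first n0 R _ _ _ nb).
  by rewrite expectD expect_cst// lerD// slush_mixed.
rewrite -ms expect_add.
pose X h1 : R := \sum_(t < m) expect t.+1 (fun h => (mixed k (slush alpha first A x (h ++ h1)))%:R).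
pose K : R := m%:R * n%:R * 2^-1 ^+ (2 * T - s) + n%:R * (2 ^+ (2 * T + s) * (3 / 5) ^+ m).
have X0 h1 : 0 <= X h1 by apply: sumr_ge0 => t _; apply: expect_ge0.
have K0 : 0 <= K.
  by rewrite addr_ge0// !mulr_ge0// exprn_ge0// ?invr_ge0//; lra.
apply: (@le_trans _ _ (expect s (fun h1 => (mixed k (slush alpha first A x h1))%:R +
   \sum_i (slush alpha first A x h1 i == None)%:R + ((2 * n + 3)%:R * X h1 + K)))).
  apply: le_expect => h1 h1s.
  have le1 : expect m (fun h =>
      (~~ consensus x (blizzard alpha (2 * T) first A x (h ++ h1)))%:R) <= 1 :> R.
    by rewrite -[leRHS](expect_cst m 1 S0) le_expect// => h _; case: consensus.
  have r0 : 0 <= (2 * n + 3)%:R * X h1 + K by rewrite addr_ge0// mulr_ge0.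
  case: (boolP (mixed _ _)) => [_|mx].
    by apply: le_trans le1 _; rewrite -addrA lerDl addr_ge0// sumr_ge0.
  case: (boolP (all_active (slush alpha first A x h1))) => [xa|]; last first.
    rewrite negb_forall => /existsP[i]; rewrite negbK => xi.
    apply: le_trans le1 _; rewrite add0r (bigD1 i)//= xi -addrA lerDl addr_ge0//.
    by rewrite sumr_ge0.
  have [b nb] : exists b, near k b (slush alpha first A x h1).
    by move: mx; rewrite /mixed negb_and !negbK => /orP[]; eexists; eassumption.
  have hs1 : (size h1 < 2 * T)%N by rewrite h1s.
  apply: le_trans (expect_not_consensus_from m bA hs1 xa nb (xv b)) _.
  rewrite h1s -addrA -/(X h1) -/K lerDr addr_ge0//.
  by rewrite sumr_ge0.
rewrite expectD [X in X + _]expectD [X in _ + X]expectD expectZ expect_sum expect_cst//.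
have hX : expect s X <= m%:R * delta.
  rewrite /X expect_sum natr_mul_sum ler_sum// => t _.
  rewrite -(expect_add _ _ (fun h => (mixed k (slush alpha first A x h))%:R)).
  by apply: mixed_late => //; rewrite /s; lia.
have su : (s <= T + u)%N by rewrite /s addnC.
have := tail m s _ ms su hX; rewrite -addrA -/K => tl.
apply: (@le_trans _ _ (delta + n%:R * (delta + p) +
    ((7 * T * (2 * n + 3))%:R * delta + (n * (7 * T + 1))%:R * p))).
  apply: lerD; last exact: tl.
  apply: lerD; first by apply: mixed_late => //; rewrite /s leq_addl.
  rewrite natr_mul_sum ler_sum// => i _; exact: bot.
have -> (d e : R) : d + n%:R * (d + e) +
    ((7 * T * (2 * n + 3))%:R * d + (n * (7 * T + 1))%:R * e) =
  (1 + n + 7 * T * (2 * n + 3))%:R * d + (n * (7 * T + 2))%:R * e.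
  by ring.
by rewrite -ms.
Qed.

End Bound.
End Finite.

(** * Negligible functions *)

Section Negligible.
Variable R : realType.
Implicit Types (f g : nat -> R) (p r : {poly R}).

Lemma negligible_le f g (m : nat) : (forall beta, (m <= beta)%N -> f beta <= g beta) ->
  negligible g -> negligible f.
Proof.
move=> fg ng p; have [b0 hb0] := ng p; exists (maxn m b0) => beta.
rewrite geq_max => /andP[mb b0b] p0; apply: le_trans (fg _ mb) _; exact: hb0.
Qed.

Lemma negligibleD f g : negligible f -> negligible g ->
  negligible (fun beta => f beta + g beta).
Proof.
move=> nf ng p; have [b1 h1] := nf (2 *: p); have [b2 h2] := ng (2 *: p).
exists (maxn b1 b2) => beta; rewrite geq_max => /andP[hb1 hb2] p0.
have p2 : 0 < (2 *: p).[beta%:R] by rewrite hornerZ mulr_gt0.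
apply: le_trans (lerD (h1 _ hb1 p2) (h2 _ hb2 p2)) _.
by rewrite hornerZ !div1r invfM; lra.
Qed.

(** The multiplier [1 + r * r] is positive and dominates [r] whatever its sign. *)
Lemma negligibleM f r : (forall beta, 0 <= f beta) -> negligible f ->
  negligible (fun beta => r.[beta%:R] * f beta).
Proof.
move=> f0 nf p; have [b0 h0] := nf (p * (1 + r * r)); exists b0 => beta hb p0.
set z := r.[beta%:R]; have z2 : 0 < 1 + z * z by nra.
have pz : (p * (1 + r * r)).[beta%:R] = p.[beta%:R] * (1 + z * z).
  by rewrite !hornerE.
have h : f beta <= 1 / (p * (1 + r * r)).[beta%:R].
  by apply: h0; rewrite // pz mulr_gt0.
rewrite pz in h; apply: (@le_trans _ _ ((1 + z * z) * f beta)).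
  by rewrite ler_wpM2r//; nra.
move: h; rewrite ler_pdivlMr ?mulr_gt0// => h.
by rewrite ler_pdivlMr//; lra.
Qed.

Lemma poly_le_pow p : exists (K : R) (d : nat), 0 < K /\
  forall beta : nat, (0 < beta)%N -> p.[beta%:R] <= K * beta%:R ^+ d.
Proof.
exists (1 + \sum_(i < size p) `|p`_i|), (size p); split.
  by rewrite ltr_pwDl// sumr_ge0.
move=> beta b0; have b1 : 1 <= beta%:R :> R by rewrite ler1n.
rewrite horner_coef mulrDl mul1r mulr_suml -[leLHS]add0r lerD ?exprn_ge0// ler_sum// => i _.
apply: le_trans (ler_norm _) _; rewrite normrM ler_wpM2l// ger0_norm ?exprn_ge0//.
by apply: ler_weXn2l => //; apply: ltnW.
Qed.

(** Bernoulli's inequality for the powers of [c^-1]. *)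
Lemma mulrn_expr_le (c : R) : 0 < c < 1 -> exists B : R,
  forall beta : nat, beta%:R * c ^+ beta <= B.
Proof.
move=> /andP[c0 c1]; exists (c^-1 - 1)^-1 => beta.
have x0 : 0 < c^-1 - 1 by rewrite subr_gt0 invf_gt1.
have bern m : m%:R * (c^-1 - 1) <= c^-1 ^+ m.
  set x := c^-1 - 1 in x0 *; have -> : c^-1 = 1 + x by rewrite /x; lra.
  suff : 1 + m%:R * x <= (1 + x) ^+ m by lra.
  elim: m => [|m IH]; first by rewrite mul0r addr0.
  rewrite exprS; apply: le_trans (ler_wpM2l _ IH); last lra.
  by rewrite -natr1; have : 0 <= m%:R :> R by []; nra.
rewrite -[leRHS]mul1r ler_pdivlMr// mulrAC.
apply: le_trans (ler_wpM2r _ (bern beta)) _; first by rewrite exprn_ge0// ltW.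
by rewrite -exprMn mulVf ?gt_eqF// expr1n.
Qed.

(* [c] is at most the [d.+1]-st power of some [s < 1], and [beta * s ^ beta]
   is bounded. *)
Lemma negligible_expr (c : R) : 0 < c < 1 -> negligible (fun beta => c ^+ beta).
Proof.
move=> /andP[c0 c1] p; have [K [d [K0 pK]]] := poly_le_pow p.
(* Chosen so that Bernoulli gives [s ^+ d.+1 >= 1 - d.+1 * y = c]. *)
pose y : R := (1 - c) / d.+1%:R; pose s := 1 - y.
have d0 : 0 < d.+1%:R :> R by rewrite ltr0n.
have d1 : 1 <= d.+1%:R :> R by rewrite ler1n.
have y0 : 0 < y by rewrite divr_gt0// subr_gt0.
have yc : y <= 1 - c by rewrite ler_pdivrMr//; nra.
have sc : c <= s ^+ d.+1.
  have bern m : 1 - m%:R * y <= s ^+ m.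
    elim: m => [|m IH]; first by rewrite mul0r subr0.
    rewrite exprS; apply: le_trans (ler_wpM2l _ IH); last by rewrite /s; lra.
    by rewrite /s -natr1; have : 0 <= m%:R :> R by []; nra.
  by apply: le_trans (bern d.+1); rewrite /y mulrC divfK ?gt_eqF//; lra.
have [B hB] : exists B : R, forall beta : nat, beta%:R * s ^+ beta <= B.
  by apply: mulrn_expr_le; rewrite /s; lra.
have s0 : 0 <= s by rewrite /s; lra.
have B0 : 0 <= B by apply: le_trans (hB 0%N); rewrite mul0r.
have KB0 : 0 <= K * B ^+ d.+1 by rewrite mulr_ge0 ?exprn_ge0// ltW.
exists (Num.bound (K * B ^+ d.+1)).+1 => beta hb p0.
have beta0 : (0 < beta)%N by apply: leq_ltn_trans hb.
have beta0' : 0 < beta%:R :> R by rewrite ltr0n.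
rewrite ler_pdivlMr// mulrC.
apply: (@le_trans _ _ (K * beta%:R ^+ d * c ^+ beta)).
  by rewrite ler_wpM2r ?pK// exprn_ge0// ltW.
(* The extra factor [beta] completes the power [d.+1]; the remaining constant is below [beta] by the
   choice of threshold. *)
rewrite -(ler_pM2l beta0') mulr1.
have -> : beta%:R * (K * beta%:R ^+ d * c ^+ beta) = K * (beta%:R ^+ d.+1 * c ^+ beta).
  by rewrite exprS; ring.
apply: (@le_trans _ _ (K * B ^+ d.+1)).
  rewrite ler_wpM2l ?(ltW K0)//.
  apply: (@le_trans _ _ ((beta%:R * s ^+ beta) ^+ d.+1)).
    rewrite exprMn -exprM mulnC exprM ler_wpM2l ?exprn_ge0//.
    by rewrite lerXn2r ?nnegrE ?exprn_ge0// ltW.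
  by rewrite lerXn2r ?nnegrE// mulr_ge0 ?exprn_ge0.
apply: ltW; apply: lt_le_trans (archi_boundP KB0) _.
by rewrite ler_nat ltnW.
Qed.

End Negligible.

(** * Worst-case executions *)

Lemma attained_max (X : Type) (P : X -> Prop) (f : X -> nat) (M : nat) :
  (exists x, P x) -> (forall x, P x -> f x <= M)%N ->
  exists2 x, P x & forall y, P y -> (f y <= f x)%N.
Proof.
move=> [x0 Px0] fM; pose Q := fun m => `[< exists2 x, P x & f x = m >].
have exQ : exists m, Q m by exists (f x0); apply/asboolP; exists x0.
have bQ m : Q m -> (m <= M)%N by move=> /asboolP[x Px <-]; apply: fM.
case: (ex_maxnP exQ bQ) => m /asboolP[x Px fx] maxm; exists x => // y Py.
by rewrite fx; apply: maxm; apply/asboolP; exists y.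
Qed.

(** Turns negligibility along each sequence of executions into a bound uniform over executions at
    each [beta]: there are infinitely many adversaries, but only finitely many probabilities. *)
Lemma Pr_attained_max (R : realType) (n k N : nat) (X : Type) (P : X -> Prop)
    (E : X -> pred (N.-tuple (samples n k))) : (exists x, P x) ->
  exists2 x, P x & forall y, P y -> Pr R (E y) <= Pr R (E x).
Proof.
move=> exP; have [] := @attained_max X P (fun x => #|E x|) #|{: N.-tuple (samples n k)}| exP.
  by move=> x _; apply: max_card.
by move=> x Px maxx; exists x => // y /maxx le_yx; rewrite ler_wpM2r ?invr_ge0// ler_nat.
Qed.

(** For such [n] the deviation [C * sqrt n] is at most [n / (40 k)]. *)
Lemma mixed_not_almost_agree (R : realType) (C : R) (n k m : nat) (o : opinions n) :
  C <= m%:R -> (40 * k * m)%:R <= Num.sqrt n%:R :> R -> mixed k o -> ~~ almost_agree C o.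
Proof.
move=> Cm ms; apply: contraL => /existsP[b hb].
suff : near k b o by rewrite /mixed; case: b {hb} => ->; rewrite ?andbF.
rewrite /near; have := cardsC [set i | o i == Some b].
rewrite (_ : ~: _ = [set i | o i != Some b]); last by apply/setP => i; rewrite !inE.
rewrite card_ord => /(congr1 (fun j => j%:R : R)); rewrite natrD => on.
have s0 : 0 <= Num.sqrt n%:R :> R by rewrite sqrtr_ge0.
have s2 : Num.sqrt n%:R * Num.sqrt n%:R = n%:R :> R by rewrite -expr2 sqr_sqrtr.
rewrite -(ler_nat R) -s2; apply: le_trans (ler_wpM2r s0 ms).
rewrite (natrM _ (40 * k) #|_|) (natrM _ (40 * k) m) -mulrA ler_wpM2l//.
have := ler_wpM2r s0 Cm; lra.
Qed.

Lemma sqrt_bound_ge (R : realType) (j n : nat) : (j ^ 2 <= n)%N -> j%:R <= Num.sqrt n%:R :> R.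
Proof.
move=> jn; rewrite -[leLHS]ger0_norm// -sqrtr_sqr ler_sqrt// -natrX ler_nat//.
Qed.

(** Gives all [n <= m] a common rate of decay, as they have at most [(m ^ k) ^ m] samples per
    round. *)
Lemma decay_le (R : realFieldType) (n k m t beta : nat) :
  (0 < n)%N -> (n <= m)%N -> (beta <= t)%N ->
  2 ^+ n * (1 - (2 * #|samples n k|%:R)^-1) ^+ t <=
  2 ^+ m * (1 - (2 * ((m ^ k) ^ m)%:R)^-1) ^+ beta :> R.
Proof.
move=> n0 nm bt; set M : R := #|samples n k|%:R; set M' : R := ((m ^ k) ^ m)%:R.
have M1 : 1 <= M by rewrite ler1n card_ffun expn_gt0 card_tuple_gt0.
have MM' : M <= M'.
  rewrite ler_nat card_ffun card_tuple !card_ord.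
  apply: (@leq_trans ((m ^ k) ^ n)%N); last first.
    by rewrite leq_pexp2l// expn_gt0 (leq_trans n0 nm).
  by rewrite leq_exp2r//; case: (k) => [|k']; rewrite ?expn0 ?leq_exp2r.
move: M M' M1 MM' => M M' M1 MM'.
have i1 : (2 * M)^-1 <= 1 by rewrite invf_le1; lra.
have i2 : (2 * M')^-1 <= (2 * M)^-1 by rewrite lef_pV2 ?posrE; lra.
have i0 : 0 <= (2 * M)^-1 by rewrite invr_ge0; lra.
have y0 : 0 <= 1 - (2 * M)^-1 by lra.
apply: ler_pM; rewrite ?exprn_ge0//; first by apply: ler_weXn2l => //; lra.
apply: (@le_trans _ _ ((1 - (2 * M)^-1) ^+ beta)).
  by apply: ler_wiXn2l => //; lra.
by apply: lerXn2r; rewrite ?nnegrE//; lra.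
Qed.

Lemma bound_le_horner (R : realFieldType) (n t : nat) (p r : {poly R}) (z : R) :
  n%:R <= p.[z] -> t%:R <= r.[z] ->
  (1 + n + 7 * t * (2 * n + 3))%:R <= (1%:P + p + (7 *: r) * (2 *: p + 3%:P)).[z] /\
  (n * (7 * t + 2))%:R <= (p * (7 *: r + 2%:P)).[z].
Proof.
rewrite !(hornerD, hornerM, hornerZ, hornerC); set a := p.[z]; set b := r.[z] => na tb.
have N1 : 0 <= n%:R :> R by [].
have N2 : 0 <= t%:R :> R by [].
rewrite (natrD _ (1 + n)) (natrD _ 1) !(natrM _ _ (_ + _)) (natrD _ (2 * n)) (natrD _ (7 * t)).
rewrite (natrM _ 7) (natrM _ 2). split; last by apply: ler_pM; lra.
by apply: lerD; [lra | apply: ler_pM; lra].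
Qed.

(** * Asymptotic statement for sequences of instances *)

Theorem theorem7p4 (R : realType) (k alpha : nat)
    (hk : (2 <= k)%N) (halpha : (k < 2 * alpha)%N) (halphak : (alpha <= k)%N)
    (first : arrival_rule k) (pi : {poly R}) (C : R) :
  exists n0 c0 : nat,
  forall (n F T : nat -> nat) (rho : {poly R}),
    (forall beta, (0 < n beta)%N) ->
    (forall beta, (n beta)%:R <= pi.[beta%:R]) ->
    (forall beta, (F beta)%:R <= Num.sqrt (n beta)%:R :> R) ->
    (forall beta, (0 < F beta)%N -> (n0 <= n beta)%N) ->
    (forall beta, (c0 * beta <= T beta)%N) ->
    (forall beta, (T beta)%:R <= rho.[beta%:R]) ->
    (forall (x : forall beta, opinions (n beta))
            (A : forall beta, adversary (n beta) k),
       (forall beta, someone_proposes (x beta)) ->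
       (forall beta, bounded (F beta) (A beta)) ->
       negligible (fun beta =>
         Pr R (fun h : (T beta).-tuple (samples (n beta) k) =>
           ~~ almost_agree C (slush alpha first (A beta) (x beta) h)))) ->
    forall (x : forall beta, opinions (n beta))
           (A : forall beta, adversary (n beta) k),
      (forall beta, someone_proposes (x beta)) ->
      (forall beta, bounded (F beta) (A beta)) ->
      negligible (fun beta =>
        Pr R (fun h : (7 * T beta).-tuple (samples (n beta) k) =>
          ~~ consensus (x beta)
               (blizzard alpha (2 * T beta) first (A beta) (x beta) h))).
Proof.
have [m Cm] : exists m : nat, C <= m%:R.
  exists (Num.bound `|C|); apply: ltW.
  by apply: le_lt_trans (ler_norm C) _; apply: archi_boundP.
(* [sqrt n >= j] yields both [40 * k * F <= n] and the premise of [mixed_not_almost_agree]; the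
   successor keeps [j] at least [40 * k]. *)
pose j := (40 * k * m.+1)%N; pose N0 := (j ^ 2)%N.
have j0 : (0 < j)%N by rewrite !muln_gt0; lia.
have N00 : (0 < N0)%N by rewrite expn_gt0 j0.
(* The factor 2 makes [T./2] at least [beta]. *)
exists N0, 2%N => n F T rho n_gt0 n_pi F_sqrt F_n0 T_c0 T_rho slush_agree x A xp bA.
have hF beta : (40 * k * F beta <= n beta)%N.
  have [->|F0] := posnP (F beta); first by rewrite muln0.
  have js := sqrt_bound_ge R (F_n0 beta F0).
  have kj : (40 * k)%:R <= j%:R :> R by rewrite ler_nat leq_pmulr.
  rewrite -(ler_nat R) natrM -(sqr_sqrtr (ler0n R (n beta))) expr2.
  by apply: ler_pM => //; apply: le_trans js.
(* The rate of decay valid for every [n] up to [N0]. *)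
pose M0 : R := ((N0 ^ k) ^ N0)%:R; pose lam := 1 - (2 * M0)^-1.
have M01 : 1 <= M0 by rewrite ler1n expn_gt0 expn_gt0 N00.
have lam01 : 0 < lam < 1.
  have i0 : 0 < (2 * M0)^-1 by rewrite invr_gt0; lra.
  have i1 : (2 * M0)^-1 < 1 by rewrite invf_lt1; lra.
  by rewrite /lam; apply/andP; split; lra.
pose agree beta (w : opinions (n beta) * adversary (n beta) k) :=
  fun h : (T beta).-tuple (samples (n beta) k) =>
    ~~ almost_agree C (slush alpha first w.2 w.1 h).
pose valid beta (w : opinions (n beta) * adversary (n beta) k) :=
  someone_proposes w.1 /\ bounded (F beta) w.2.
have worst beta := @Pr_attained_max R (n beta) k (T beta) _ (@valid beta) (@agree beta)
  (ex_intro _ (x beta, A beta) (conj (xp beta) (bA beta))).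
pose w beta := s2val (cid2 (worst beta)).
have w_valid beta : valid beta (w beta) by apply: (s2valP (cid2 (worst beta))).
have w_max beta w' : valid beta w' -> Pr R (agree beta w') <= Pr R (agree beta (w beta)).
  exact: (s2valP' (cid2 (worst beta))).
(* Large and small [n] may alternate as [beta] grows, so the bounds for both are added. *)
pose delta beta := Pr R (agree beta (w beta)) + (2 ^+ N0)%:P.[beta%:R] * lam ^+ beta.
have Pr0 beta : 0 <= Pr R (agree beta (w beta)) by rewrite divr_ge0.
have lamX0 beta : 0 <= lam ^+ beta by rewrite exprn_ge0// ltW//; case/andP: lam01.
have delta_mixed beta (x' : opinions (n beta)) (A' : adversary (n beta) k) :
    someone_proposes x' -> bounded (F beta) A' ->
    expect (T beta) (fun h => (mixed k (slush alpha first A' x' h))%:R) <= delta beta.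
  move=> xp' bA'; rewrite /delta hornerC; have [large|small] := leqP N0 (n beta).
    apply: (@le_trans _ _ (Pr R (agree beta (x', A')))); last first.
      by apply: le_trans (w_max beta (x', A') (conj xp' bA')) _; rewrite lerDl mulr_ge0// exprn_ge0.
    rewrite (PrE R (T beta) (fun h => ~~ almost_agree C (slush alpha first A' x' h))).
    apply: le_expect => h _; apply: natr_imp_le; apply: mixed_not_almost_agree Cm _.
    by apply: le_trans (sqrt_bound_ge R large); rewrite ler_nat leq_mul.
  (* A positive [F] would force [n] to be at least [N0]. *)
  have F0 : F beta = 0%N by case: (posnP (F beta)) => // /F_n0; rewrite leqNgt small.
  rewrite F0 in bA'.
  apply: le_trans (expect_mixed_idle hk halpha halphak first (n_gt0 beta) R (T beta) bA' xp') _.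
  rewrite -[leLHS]add0r lerD//; apply: (decay_le _ k); first exact: n_gt0.
    exact: ltnW.
  by apply: leq_trans (T_c0 beta); rewrite leq_pmull.
have negl_delta : negligible delta.
  apply: negligibleD; last exact: negligibleM _ (negligible_expr lam01).
  by apply: (slush_agree (fun beta => (w beta).1) (fun beta => (w beta).2)) => beta;
    case: (w_valid beta).
have delta0 beta : 0 <= delta beta.
  by rewrite addr_ge0// mulr_ge0// hornerC exprn_ge0.
have q01 : 0 < (3 / 4 : R) < 1 by apply/andP; split; lra.
pose P1 : {poly R} := 1%:P + pi + (7 *: rho) * (2 *: pi + 3%:P).
pose P2 : {poly R} := pi * (7 *: rho + 2%:P).
(* The start at [beta = 1] ensures [T > 0]. *)
apply: (@negligible_le _ _ (fun beta =>
  P1.[beta%:R] * delta beta + P2.[beta%:R] * (3 / 4) ^+ beta) 1%N).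
  move=> beta beta0; have T0 : (0 < T beta)%N by have := T_c0 beta; lia.
  rewrite (PrE R (7 * T beta) (fun h => ~~ consensus (x beta)
    (blizzard alpha (2 * T beta) first (A beta) (x beta) h))).
  apply: le_trans (expect_not_consensus hk halpha halphak (n_gt0 beta) (hF beta)
    (@delta_mixed beta) T0 (xp beta) (bA beta)) _.
  have [b1 b2] := @bound_le_horner R (n beta) (T beta) pi rho beta%:R (n_pi beta) (T_rho beta).
  apply: lerD; first by rewrite ler_wpM2r.
  apply: ler_pM => //; first by rewrite exprn_ge0//; lra.
  by apply: ler_wiXn2l; [lra | lra | have := T_c0 beta; lia].
apply: negligibleD; apply: negligibleM => //; last exact: negligible_expr.
by move=> beta; rewrite exprn_ge0//; lra.
Qed.
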